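(* Let $W=\bigoplus_{i\in\Lambda}\mathbf{Z}e_i$ with $\Lambda=\mathbf{Z}^2\setminus\{(0,0)\}$, put $e_{(0,0)}:=0$, and let $W[q]=W\otimes_{\mathbf{Z}}\mathbf{Z}[q]$. Let $\Gamma=SL(2,\mathbf{Z})$ act on $W[q]$ by $\gamma(e_i)=e_{\gamma i}$, and let $\mu$ be the $\mathbf{Z}[q]$-linear map $W[q]\to W[q]$ given by $$e_{(x,y)}\mapsto e_{(x,y)}+(1-q)\,y\,e_{(-1,0)}\quad\text{if } y>0,$$ $$e_{(x,y)}\mapsto e_{(x-y,y)}-q\,y\,e_{(-1,0)}\quad\text{if } y<0,$$ $$e_{(x,0)}\mapsto e_{(x-1,0)}-e_{(-1,0)}.$$ Let $V\subset W\subset W[q]$ be the kernel of the homomorphism $W\to\mathbf{Z}^2$, $e_{(x,y)}\mapsto(x,y)$. Then $V$ is invariant under $\mu$ and under $\Gamma$, and these actions make $V$ a representation of the group $H$: there is a group homomorphism $\rho:H\to \mathrm{Aut}_{\mathbf{Z}}(V)$ such that $\rho(\gamma)=\gamma|_V$ for every $\gamma\in\Gamma$ and $\rho(IP)=\mu|_V$.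
   Context: $H$ is the subgroup of the group of birational automorphisms of $\mathbf{CP}^2$ (affine coordinates $x,y$, group law composition of maps) generated by $P:(x,y)\mapsto\left(y,\frac{1+y}{x}\right)$ and by $\Gamma=SL(2,\mathbf{Z})$, where $\begin{pmatrix}a&b\\c&d\end{pmatrix}$ acts by $(x,y)\mapsto(x^ay^b,x^cy^d)$. $I=\begin{pmatrix}0&-1\\1&0\end{pmatrix}\in\Gamma$, so $I:(x,y)\mapsto(y^{-1},x)$ and $IP:(x,y)\mapsto\left(\frac{x}{1+y},y\right)$. On $\Lambda$, $\gamma\in\Gamma$ acts by multiplication of column vectors by the matrix. *)

(* Defs.v *)
From HB Require Import structures.
From mathcomp Require Import all_boot all_order all_algebra.
From mathcomp Require Import fraction mpoly freeg complex.
From mathcomp Require Import boolp reals.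

Set Implicit Arguments.
Unset Strict Implicit.
Unset Printing Implicit Defensive.

Import Order.TTheory GRing.Theory Num.Theory.
Local Open Scope ring_scope.

(* The function field of CP^2, with affine coordinates x = 'X_0, y = 'X_1. *)
Notation ratfun R := {fraction {mpoly (complex R)[2]}}.

(* The rational map (x, y) |-> (f.1, f.2). *)
Notation ratmap R := (ratfun R * ratfun R)%type.

Section PartialValue.
Variables (A : idomainType) (F : fieldType) (frac ev : {rmorphism A -> F}).
Hypothesis frac_nz : forall d, d != 0 -> frac d != 0.

(* b is the value of the fraction a under ev, some denominator of a being
   nonzero under ev *)
Definition partial_value (a b : F) := exists n d,
  [/\ ev d != 0, a = frac n / frac d & b = ev n / ev d].

Let nz d : ev d != 0 -> frac d != 0.
Proof. by move=> d0; apply: frac_nz; apply: contraNneq d0 => ->; rewrite rmorph0. Qed.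

Lemma partial_value_base n : partial_value (frac n) (ev n).
Proof. by exists n, 1; rewrite !rmorph1 !divr1 oner_neq0. Qed.

Lemma partial_valueD a b a' b' : partial_value a b -> partial_value a' b' ->
  partial_value (a + a') (b + b').
Proof.
move=> [n [d [d0 -> ->]]] [n' [d' [d'0 -> ->]]].
exists (n * d' + n' * d), (d * d').
by rewrite !rmorphD !rmorphM mulf_neq0 // !addf_div ?nz.
Qed.

Lemma partial_valueM a b a' b' : partial_value a b -> partial_value a' b' ->
  partial_value (a * a') (b * b').
Proof.
move=> [n [d [d0 -> ->]]] [n' [d' [d'0 -> ->]]].
by exists (n * n'), (d * d'); rewrite !rmorphM mulf_neq0 // !mulf_div.
Qed.

Lemma partial_valueV a b : b != 0 -> partial_value a b -> partial_value a^-1 b^-1.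
Proof.
move=> b0 [n [d [d0 -> eb]]]; exists d, n; rewrite eb !invf_div; split => //.
by apply: contraNneq b0; rewrite eb => ->; rewrite mul0r.
Qed.

Lemma partial_value0 b : partial_value 0 b -> b = 0.
Proof.
move=> [n [d [d0 /esym/eqP e ->]]].
move: e; rewrite mulf_eq0 invr_eq0 (negPf (nz d0)) orbF => fn0.
have [->|/frac_nz] := eqVneq n 0; first by rewrite rmorph0 mul0r.
by rewrite fn0.
Qed.

Lemma partial_value_uniq n d b : (forall c, ev c = 0 -> c = 0) -> d != 0 ->
  partial_value (frac n / frac d) b -> ev n / ev d = b.
Proof.
move=> ev0 d0 [n' [d' [d'0 e ->]]].
have evd0 : ev d != 0 by apply: contra_neq d0 => /ev0.
apply/eqP; rewrite eqr_div // -!rmorphM -subr_eq0 -rmorphB.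
suff -> : n * d' - n' * d = 0 by rewrite rmorph0.
apply/eqP; apply: contraT => /frac_nz; rewrite rmorphB !rmorphM subr_eq0.
by move/eqP: e; rewrite eqr_div ?(frac_nz d0) ?(nz d'0) // => ->.
Qed.

Lemma partial_value_eq0 a : (forall c, ev c = 0 -> c = 0) ->
  partial_value a 0 -> a = 0.
Proof.
move=> ev0 [n [d [d0 -> /esym/eqP]]].
by rewrite mulf_eq0 invr_eq0 (negPf d0) orbF => /eqP/ev0->; rewrite rmorph0 mul0r.
Qed.

End PartialValue.

Record SL2Z := MkSL2Z { SL2Z_mx :> 'M[int]_2; _ : \det SL2Z_mx == 1 }.
HB.instance Definition _ := [isSub for SL2Z_mx].

Section RationalMaps.
Variable R : realType.
Local Notation C := (complex R).
Local Notation K := (ratfun R).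
Local Notation "p %:F" := (FracField.tofrac p).
Implicit Types (f g h u v w : ratmap R) (r s a b : K) (p n d : {mpoly C[2]}).

Definition cstK : {rmorphism C -> K} :=
  (@FracField.tofrac {mpoly C[2]}) \o (@mpolyC 2 C).

Definition Kx : K := ('X_(ord0 : 'I_2))%:F.
Definition Ky : K := ('X_(ord_max : 'I_2))%:F.

Definition coord v (i : 'I_2) : K := if i == ord0 then v.1 else v.2.

Definition peval v : {mpoly C[2]} -> K := mmap cstK (coord v).

HB.instance Definition _ v := GRing.RMorphism.on (peval v).

(* r(v.1, v.2). Division being total, this is meaningful only when the
   denominator of r does not vanish at v; this always holds when v is dominant,
   hence when v is birational (birat_dominant below). *)
Definition subst v r : K := peval v \n_(repr r) / peval v \d_(repr r).

Definition ratid : ratmap R := (Kx, Ky).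

Definition ratcomp f g : ratmap R := (subst g f.1, subst g f.2).

Definition dominant v := injective (peval v).

Lemma peval_cst v c : peval v c%:MP = cstK c.
Proof. exact: mmapC. Qed.

Lemma peval_X v i : peval v 'X_i = coord v i.
Proof. by rewrite /peval mmapX mmap1U. Qed.

Lemma peval0 v : peval v 0 = 0. Proof. exact: rmorph0. Qed.
Lemma peval1 v : peval v 1 = 1. Proof. exact: rmorph1. Qed.
Lemma pevalD v : {morph peval v : p q / p + q}. Proof. exact: rmorphD. Qed.
Lemma pevalB v : {morph peval v : p q / p - q}. Proof. exact: rmorphB. Qed.
Lemma pevalM v : {morph peval v : p q / p * q}. Proof. exact: rmorphM. Qed.
Lemma pevalXn v k : {morph peval v : p / p ^+ k}. Proof. exact: rmorphXn. Qed.

Lemma tofrac_nz p : p != 0 -> p%:F != 0 :> K.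
Proof. by rewrite tofrac_eq0. Qed.

Lemma frac_nd r : r = (\n_(repr r))%:F / (\d_(repr r))%:F.
Proof.
have dn0 : (\d_(repr r))%:F != 0 :> K by rewrite tofrac_eq0 denom_ratioP.
apply: (mulIf dn0); rewrite divfK //; set q := repr r.
rewrite -[r](reprK r) -/q; unlock FracField.tofrac.
rewrite -[LHS]FracField.pi_mul; apply/eqP; rewrite FracField.equivf_def.
by rewrite /FracField.mulf !numden_Ratio ?oner_neq0 ?mulr1 ?denom_ratioP // mulrC.
Qed.

Definition has_value w : K -> K -> Prop :=
  partial_value (@FracField.tofrac {mpoly C[2]}) (peval w).

Lemma has_value_poly w p : has_value w p%:F (peval w p).
Proof. exact: partial_value_base. Qed.

Lemma has_value_cst w c : has_value w (cstK c) (cstK c).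
Proof. by rewrite -[X in has_value w _ X](peval_cst w); apply: has_value_poly. Qed.

Lemma has_value00 w : has_value w 0 0.
Proof. by rewrite -[X in has_value w _ X](peval0 w) -(tofrac0 _); apply: has_value_poly. Qed.

Lemma has_value11 w : has_value w 1 1.
Proof. by rewrite -[X in has_value w _ X](peval1 w) -(tofrac1 _); apply: has_value_poly. Qed.

Lemma has_valueD w a b a' b' : has_value w a b -> has_value w a' b' ->
  has_value w (a + a') (b + b').
Proof. exact/partial_valueD/tofrac_nz. Qed.

Lemma has_valueM w a b a' b' : has_value w a b -> has_value w a' b' ->
  has_value w (a * a') (b * b').
Proof. exact: partial_valueM. Qed.

Lemma has_valueV w a b : b != 0 -> has_value w a b -> has_value w a^-1 b^-1.
Proof. exact: partial_valueV. Qed.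

Lemma has_valueXn w a b k : has_value w a b -> has_value w (a ^+ k) (b ^+ k).
Proof.
move=> ab; elim: k => [|k IHk]; first exact: has_value11.
by rewrite !exprS; apply: has_valueM.
Qed.

Lemma has_valueXz w a b (k : int) : b != 0 -> has_value w a b ->
  has_value w (a ^ k) (b ^ k).
Proof.
move=> b0 ab; case: k => k; first exact: has_valueXn.
rewrite !NegzE -!exprnN; apply: has_valueV; last exact: has_valueXn.
by rewrite expf_neq0.
Qed.

Lemma has_value0 w b : has_value w 0 b -> b = 0.
Proof. exact/partial_value0/tofrac_nz. Qed.

Lemma has_value_coord w i : has_value w ('X_i)%:F (coord w i).
Proof. by rewrite -peval_X; apply: has_value_poly. Qed.

Lemma coord_id i : coord ratid i = ('X_i)%:F.
Proof.
rewrite /coord /ratid /Kx /Ky; case: eqVneq => [->//|i0]; congr (('X_ _)%:F).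
by apply: val_inj; case: i i0 => [[|[|[]]]].
Qed.

Lemma has_value_peval v w u p :
    has_value w v.1 u.1 -> has_value w v.2 u.2 ->
  has_value w (peval v p) (peval u p).
Proof.
move=> v1 v2; elim/mpolyind: p => [|c m p _ _ IHp].
  by rewrite !peval0; apply: has_value00.
rewrite !pevalD -mul_mpolyC !pevalM !peval_cst.
apply: has_valueD => //; apply: has_valueM; first exact: has_value_cst.
rewrite /peval !mmapX /mmap1.
apply: (big_ind2 (has_value w)) => [|x1 x2 y1 y2|i _]; first exact: has_value11.
  exact: has_valueM.
by apply: has_valueXn; rewrite /coord; case: ifP.
Qed.

Lemma peval_id p : peval ratid p = p%:F.
Proof.
elim/mpolyind: p => [|c m p _ _ IHp]; first by rewrite peval0 tofrac0.
rewrite pevalD tofracD IHp -mul_mpolyC pevalM tofracM peval_cst.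
congr (_ * _ + _); rewrite /peval mmapX mpolyXE_id rmorph_prod /mmap1.
by apply: eq_bigr => i _; rewrite coord_id rmorphXn.
Qed.

Lemma dominantP v : (forall p, peval v p = 0 -> p = 0) -> dominant v.
Proof.
move=> v0 p q /eqP; rewrite -subr_eq0 -pevalB => /eqP /v0/eqP.
by rewrite subr_eq0 => /eqP.
Qed.

Lemma dominant0 v p : dominant v -> peval v p = 0 -> p = 0.
Proof. by move=> dv; rewrite -(peval0 v) => /dv. Qed.

Lemma has_value_dominant v w : has_value w v.1 Kx -> has_value w v.2 Ky ->
  dominant v.
Proof.
move=> v1 v2; apply: dominantP => p pv0.
have := has_value_peval (u := ratid) p v1 v2.
rewrite pv0 peval_id => /has_value0/eqP; rewrite tofrac_eq0.
by move/eqP.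
Qed.

Lemma X_neq0 i : ('X_i : {mpoly C[2]})%:F != 0 :> K.
Proof.
rewrite tofrac_eq0; apply/eqP => /mpolyP /(_ U_(i)%MM)/eqP.
by rewrite mcoeffX eqxx mcoeff0 oner_eq0.
Qed.

Lemma subst_value w r : peval w \d_(repr r) != 0 -> has_value w r (subst w r).
Proof.
move=> d0; exists \n_(repr r), \d_(repr r).
split; [exact d0 | exact (frac_nd r) | reflexivity].
Qed.

Lemma dominant_value v r : dominant v -> has_value v r (subst v r).
Proof.
move=> dv; apply: subst_value; apply/eqP => /(dominant0 dv)/eqP.
by rewrite (negPf (denom_ratioP _)).
Qed.

Lemma inv_dominant v w : ratcomp v w = ratid -> dominant v.
Proof.
move=> [e1 e2].
have val r i : subst w r = ('X_i)%:F -> has_value w r ('X_i)%:F.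
  move=> e; rewrite -e; apply: subst_value; apply/eqP => d0.
  by move: e; rewrite /subst d0 invr0 mulr0; apply/nesym/eqP/X_neq0.
by apply: (@has_value_dominant v w); apply: val.
Qed.

Lemma substE v r b : dominant v -> has_value v r b -> subst v r = b.
Proof.
move=> dv; rewrite {1}[r]frac_nd; apply: partial_value_uniq.
- exact: tofrac_nz.
- by move=> c; apply: dominant0.
- exact: denom_ratioP.
Qed.

Lemma subst_peval v w p : dominant w ->
  subst w (peval v p) = peval (ratcomp v w) p.
Proof.
by move=> dw; apply: substE => //; apply: has_value_peval; apply: dominant_value.
Qed.

Lemma substM w r s : dominant w -> subst w (r * s) = subst w r * subst w s.
Proof. by move=> dw; apply: substE => //; apply: has_valueM; apply: dominant_value. Qed.

Lemma substV w r : dominant w -> subst w r^-1 = (subst w r)^-1.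
Proof.
move=> dw; apply: substE => //.
have [r0|r0] := eqVneq (subst w r) 0; last first.
  by apply: has_valueV => //; apply: dominant_value.
suff -> : r = 0.
  rewrite (_ : subst w 0 = 0) ?invr0; first exact: has_value00.
  by apply: substE => //; apply: has_value00.
have := dominant_value r dw; rewrite r0.
by apply: partial_value_eq0 => c; apply: dominant0.
Qed.

Lemma subst_comp v w r : dominant w ->
  subst w (subst v r) = subst (ratcomp v w) r.
Proof.
by move=> dw; rewrite {2}/subst substM // substV // !subst_peval.
Qed.

Lemma ratcompA f g h : dominant h ->
  ratcomp f (ratcomp g h) = ratcomp (ratcomp f g) h.
Proof. by move=> dh; rewrite /ratcomp /= !subst_comp. Qed.

Lemma ratcomp_id f : ratcomp f ratid = f.
Proof.
by case: f => f1 f2; rewrite /ratcomp /subst /= !peval_id -!frac_nd.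
Qed.

Lemma ratid_comp f : dominant f -> ratcomp ratid f = f.
Proof.
move=> df; rewrite [RHS]surjective_pairing /ratcomp.
rewrite (substE df (has_value_coord f ord0)).
by rewrite (substE df (has_value_coord f ord_max)).
Qed.

(* The group Bir(CP^2): a birational map is given together with its
   (unique) inverse. *)
Record birat := Birat {
  birat_pair : ratmap R * ratmap R;
  _ : (ratcomp birat_pair.1 birat_pair.2 == ratid) &&
      (ratcomp birat_pair.2 birat_pair.1 == ratid) }.

HB.instance Definition _ := [isSub for birat_pair].
HB.instance Definition _ := [Choice of birat by <:].

Definition birat_map (phi : birat) : ratmap R := (val phi).1.

Lemma birat_compV (phi : birat) : ratcomp (val phi).1 (val phi).2 = ratid.
Proof. by have /andP[/eqP] := valP phi. Qed.

Lemma birat_Vcomp (phi : birat) : ratcomp (val phi).2 (val phi).1 = ratid.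
Proof. by have /andP[_ /eqP] := valP phi. Qed.

Lemma birat_dominant phi : dominant (birat_map phi).
Proof. exact: inv_dominant (birat_compV phi). Qed.

Lemma biratV_dominant (phi : birat) : dominant (val phi).2.
Proof. exact: inv_dominant (birat_Vcomp phi). Qed.

Lemma ratinv_uniq f g h : ratcomp f g = ratid -> ratcomp g f = ratid ->
  ratcomp h f = ratid -> h = g.
Proof.
move=> fg gf hf; have dg := inv_dominant gf.
by rewrite -[h]ratcomp_id -fg ratcompA // hf ratid_comp.
Qed.

Lemma birat_map_inj : injective birat_map.
Proof.
move=> phi psi; rewrite /birat_map => e; apply: val_inj.
have := @ratinv_uniq _ _ (val phi).2 (birat_compV psi) (birat_Vcomp psi).
rewrite -e (birat_Vcomp phi) => /(_ erefl) e2.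
by rewrite [LHS]surjective_pairing [RHS]surjective_pairing e e2.
Qed.

Fact birat_one_subproof :
  (ratcomp ratid ratid == ratid) && (ratcomp ratid ratid == ratid).
Proof. by rewrite ratcomp_id eqxx. Qed.

Definition birat_one : birat := @Birat (ratid, ratid) birat_one_subproof.

Fact birat_inv_subproof (phi : birat) :
  (ratcomp (val phi).2 (val phi).1 == ratid) &&
  (ratcomp (val phi).1 (val phi).2 == ratid).
Proof. by rewrite birat_compV birat_Vcomp eqxx. Qed.

Definition birat_inv phi : birat :=
  @Birat ((val phi).2, (val phi).1) (birat_inv_subproof phi).

Fact birat_mul_subproof (phi psi : birat) :
  let f := ratcomp (val phi).1 (val psi).1 in
  let g := ratcomp (val psi).2 (val phi).2 in
  (ratcomp f g == ratid) && (ratcomp g f == ratid).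
Proof.
have aux (al be : birat) :
    ratcomp (ratcomp (val al).1 (val be).1) (ratcomp (val be).2 (val al).2) = ratid.
  rewrite ratcompA; last exact: biratV_dominant.
  rewrite -(ratcompA (val al).1); last exact: biratV_dominant.
  by rewrite birat_compV ratcomp_id birat_compV.
by rewrite /= aux (aux (birat_inv psi) (birat_inv phi)) eqxx.
Qed.

Definition birat_mul phi psi : birat := @Birat
  (ratcomp (val phi).1 (val psi).1, ratcomp (val psi).2 (val phi).2)
  (birat_mul_subproof phi psi).

Fact birat_mulA : associative birat_mul.
Proof.
move=> a b c; apply: birat_map_inj; rewrite /birat_map /=.
by apply: ratcompA; apply: birat_dominant.
Qed.

Fact birat_mul1 : left_id birat_one birat_mul.
Proof. by move=> a; apply: birat_map_inj; apply: ratid_comp; apply: birat_dominant. Qed.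

Fact birat_mulr1 : right_id birat_one birat_mul.
Proof. by move=> a; apply: birat_map_inj; apply: ratcomp_id. Qed.

Fact birat_mulV : left_inverse birat_one birat_inv birat_mul.
Proof. by move=> a; apply: birat_map_inj; apply: birat_Vcomp. Qed.

Fact birat_mulrV : right_inverse birat_one birat_inv birat_mul.
Proof. by move=> a; apply: birat_map_inj; apply: birat_compV. Qed.

HB.instance Definition _ := isGroup.Build birat
  birat_mulA birat_mul1 birat_mulr1 birat_mulV birat_mulrV.

(* P : (x, y) |-> (y, (1 + y) / x), with inverse (x, y) |-> ((1 + x) / y, x). *)
Definition P_map : ratmap R := (Ky, (1 + Ky) / Kx).
Definition PV_map : ratmap R := ((1 + Kx) / Ky, Kx).

Let has_x w : has_value w Kx w.1 := has_value_coord w ord0.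
Let has_y w : has_value w Ky w.2 := has_value_coord w ord_max.

Lemma Kx_neq0 : Kx != 0. Proof. exact: X_neq0. Qed.
Lemma Ky_neq0 : Ky != 0. Proof. exact: X_neq0. Qed.

Lemma add1X_neq0 i : 1 + ('X_i)%:F != 0 :> K.
Proof.
rewrite -tofrac1 -tofracD tofrac_eq0; apply/eqP => /mpolyP /(_ U_(i)%MM)/eqP.
by rewrite mcoeffD mcoeff1 mcoeffX eqxx mcoeff0 mnm1_eq0 add0r oner_eq0.
Qed.

Let div2 (F : fieldType) (a b : F) : a != 0 -> a / (a / b) = b.
Proof. by move=> a0; rewrite invf_div mulrCA divff // mulr1. Qed.

Let P_value : has_value PV_map P_map.1 Kx /\ has_value PV_map P_map.2 Ky.
Proof.
split; first exact: has_y.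
rewrite -[X in has_value _ _ X](div2 Ky (add1X_neq0 ord0)).
apply: has_valueM; first by apply: has_valueD; [exact: has_value11 | exact: has_y].
apply: has_valueV; last exact: has_x.
by rewrite mulf_neq0 ?invr_eq0 ?Ky_neq0 //; apply: add1X_neq0.
Qed.

Let PV_value : has_value P_map PV_map.1 Kx /\ has_value P_map PV_map.2 Ky.
Proof.
split; last exact: has_x.
rewrite -[X in has_value _ _ X](div2 Kx (add1X_neq0 ord_max)).
apply: has_valueM; first by apply: has_valueD; [exact: has_value11 | exact: has_x].
apply: has_valueV; last exact: has_y.
by rewrite mulf_neq0 ?invr_eq0 ?Kx_neq0 //; apply: add1X_neq0.
Qed.

Lemma value_ratcomp f g h : dominant g ->
  has_value g f.1 h.1 -> has_value g f.2 h.2 -> ratcomp f g = h.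
Proof.
by move=> dg h1 h2; rewrite /ratcomp !(substE dg h1, substE dg h2) -surjective_pairing.
Qed.

Fact P_subproof : (ratcomp P_map PV_map == ratid) && (ratcomp PV_map P_map == ratid).
Proof.
have [[h1 h2] [k1 k2]] := (P_value, PV_value).
have dP := has_value_dominant h1 h2; have dV := has_value_dominant k1 k2.
by apply/andP; split; apply/eqP; apply: value_ratcomp.
Qed.

Definition birP : birat := @Birat (P_map, PV_map) P_subproof.

(* (x, y) |-> (x^a y^b, x^c y^d) for M = [a, b; c, d], with integer exponents *)
Definition mono (M : 'M[int]_2) : ratmap R :=
  (Kx ^ M ord0 ord0 * Ky ^ M ord0 ord_max,
   Kx ^ M ord_max ord0 * Ky ^ M ord_max ord_max).

Let mono_alg (F : fieldType) (x y : F) (a b c d e f : int) : x != 0 -> y != 0 ->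
  (x ^ a * y ^ b) ^ e * (x ^ c * y ^ d) ^ f
    = x ^ (e * a + f * c) * y ^ (e * b + f * d).
Proof.
move=> x0 y0; rewrite !exprzMl ?unitfE ?expfz_neq0 // !exprz_exp.
rewrite ![(e * _)]mulrC ![(f * _)]mulrC !expfzDr //.
by rewrite mulrACA.
Qed.

Let mono_neq0 (F : fieldType) (x y : F) (j k : int) : x != 0 -> y != 0 ->
  x ^ j * y ^ k != 0.
Proof. by move=> x0 y0; rewrite mulf_neq0 // expfz_neq0. Qed.

Let mono_value (M N : 'M[int]_2) :
  has_value (mono N) (mono M).1 (mono (M *m N)).1 /\
  has_value (mono N) (mono M).2 (mono (M *m N)).2.
Proof.
have hX (i : 'I_2) : has_value (mono N) (Kx ^ M i ord0 * Ky ^ M i ord_max)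
    (Kx ^ (M *m N) i ord0 * Ky ^ (M *m N) i ord_max).
  have mE k : (M *m N) i k = M i ord0 * N ord0 k + M i ord_max * N ord_max k.
    rewrite !mxE big_ord_recl big_ord1; congr (_ + M _ _ * N _ _); exact: val_inj.
  rewrite !mE -(mono_alg _ _ _ _ _ _ Kx_neq0 Ky_neq0).
  have nz (j k : int) : Kx ^ j * Ky ^ k != 0.
    exact: mono_neq0 Kx_neq0 Ky_neq0.
  apply: has_valueM; apply: has_valueXz; try exact: nz.
    exact: has_x.
  exact: has_y.
by split; apply: hX.
Qed.

Lemma mono1 : mono 1%:M = ratid.
Proof. by rewrite /mono !mxE /= mulr1 mul1r. Qed.

Lemma mono_dominant (M : 'M[int]_2) : M \in unitmx -> dominant (mono M).
Proof.
move=> uM; have [] := mono_value M (invmx M); rewrite mulmxV // mono1.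
exact: has_value_dominant.
Qed.

Lemma monoM M N : N \in unitmx -> ratcomp (mono M) (mono N) = mono (M *m N).
Proof.
by move=> uN; have [h1 h2] := mono_value M N; apply: value_ratcomp (mono_dominant uN) _ _.
Qed.

Lemma SL2Z_unit (g : SL2Z) : val g \in unitmx.
Proof. by rewrite unitmxE (eqP (valP g)) unitr1. Qed.

Fact mono_subproof (g : SL2Z) :
  (ratcomp (mono (val g)) (mono (invmx (val g))) == ratid) &&
  (ratcomp (mono (invmx (val g))) (mono (val g)) == ratid).
Proof.
by rewrite !monoM ?unitmx_inv ?SL2Z_unit // mulmxV ?mulVmx ?SL2Z_unit // mono1 eqxx.
Qed.

Definition birmono (g : SL2Z) : birat :=
  @Birat (mono (val g), mono (invmx (val g))) (mono_subproof g).

Inductive in_H : birat -> Prop :=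
| H_P : in_H birP
| H_SL2Z (g : SL2Z) : in_H (birmono g)
| H_one : in_H 1%g
| H_mul phi psi : in_H phi -> in_H psi -> in_H (phi * psi)%g
| H_inv phi : in_H phi -> in_H phi^-1%g.

Definition H_pred : {pred birat} := fun phi => `[< in_H phi >].

Fact H_group_closed : group_closed H_pred.
Proof.
split; first exact/asboolP/H_one.
move=> phi psi /asboolP hphi /asboolP hpsi.
by apply/asboolP/H_mul/H_inv.
Qed.

Record groupH := MkH { H_birat :> birat; _ : H_birat \in H_pred }.
HB.instance Definition _ := [isSub for H_birat].
HB.instance Definition _ := [Choice of groupH by <:].
HB.instance Definition _ := SubChoice_isSubGroup.Build _ _ groupH H_group_closed.

Definition HP : groupH := @MkH birP (asboolT H_P).
Definition HSL2Z (g : SL2Z) : groupH := @MkH (birmono g) (asboolT (H_SL2Z g)).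

End RationalMaps.

(* Aut_Z(V) *)
Section Automorphisms.
Variable V : zmodType.

Record zaut := ZAut {
  zaut_fun :> V -> V;
  zaut_additive : zmod_morphism zaut_fun;
  zaut_bij : bijective zaut_fun }.

HB.instance Definition _ := gen_eqMixin zaut.
HB.instance Definition _ := gen_choiceMixin zaut.

HB.instance Definition _ (f : zaut) :=
  GRing.isZmodMorphism.Build V V (zaut_fun f) (zaut_additive f).

Lemma zautP (f g : zaut) : f =1 g -> f = g.
Proof.
case: f g => [f af bf] [g ag bg] /= /funext efg.
by case: _ / efg in ag bg *; congr ZAut; apply: Prop_irrelevance.
Qed.

Fact id_zmod_morphism : zmod_morphism (@id V). Proof. by []. Qed.

Definition zaut_one := @ZAut id id_zmod_morphism (inv_bij (fun _ => erefl)).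

Fact comp_zmod_morphism (f g : zaut) : zmod_morphism (f \o g).
Proof. by move=> u v /=; rewrite !raddfB. Qed.

Definition zaut_mul (f g : zaut) :=
  ZAut (@comp_zmod_morphism f g) (bij_comp (zaut_bij f) (zaut_bij g)).

Fact zaut_inv_subproof (f : zaut) :
  { g : V -> V | cancel f g /\ cancel g f }.
Proof. by apply: cid; case: (zaut_bij f) => g fg gf; exists g. Qed.

Definition zaut_inv_fun f := sval (zaut_inv_subproof f).

Fact zaut_fK (f : zaut) : cancel f (zaut_inv_fun f).
Proof. by have [] := svalP (zaut_inv_subproof f). Qed.

Fact zaut_invK (f : zaut) : cancel (zaut_inv_fun f) f.
Proof. by have [] := svalP (zaut_inv_subproof f). Qed.

Fact zaut_inv_additive (f : zaut) : zmod_morphism (zaut_inv_fun f).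
Proof.
by move=> u v; apply: (can_inj (zaut_fK f)); rewrite zaut_additive !zaut_invK.
Qed.

Definition zaut_inv f : zaut := @ZAut (zaut_inv_fun f)
  (zaut_inv_additive f) (Bijective (zaut_invK f) (zaut_fK f)).

Fact zaut_mulA : associative zaut_mul.
Proof. by move=> f g h; apply: zautP. Qed.

Fact zaut_mul1 : left_id zaut_one zaut_mul.
Proof. by move=> f; apply: zautP. Qed.

Fact zaut_mulr1 : right_id zaut_one zaut_mul.
Proof. by move=> f; apply: zautP. Qed.

Fact zaut_mulV : left_inverse zaut_one zaut_inv zaut_mul.
Proof. by move=> f; apply: zautP; apply: zaut_fK. Qed.

Fact zaut_mulrV : right_inverse zaut_one zaut_inv zaut_mul.
Proof. by move=> f; apply: zautP; apply: zaut_invK. Qed.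

HB.instance Definition _ := isGroup.Build zaut
  zaut_mulA zaut_mul1 zaut_mulr1 zaut_mulV zaut_mulrV.

End Automorphisms.

Lemma fglift_scalable (A : comNzRingType) (K : choiceType) (M : lmodType A)
  (f : K -> M) : scalable (fglift f).
Proof.
move=> c D; have fU k x : c *: << k *g x >> = << (c * k) *g x >>.
  by apply/eqP/freeg_eqP => y; rewrite coeffZ !coeffU mulrA.
rewrite -[D]freeg_sumE scaler_sumr; under eq_bigr do rewrite fU.
have fD := lift_is_additive f.
pose g : {additive {freeg K / A} -> M} := HB.pack (fglift f) (GRing.isZmodMorphism.Build _ _ _ fD).
have gs F : fglift f (\sum_(k <- dom D) F k) = \sum_(k <- dom D) fglift f (F k).
  exact: (raddf_sum g).
rewrite !gs scaler_sumr.
by apply: eq_bigr => k _; rewrite /= !liftU scalerA.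
Qed.

Definition pt (a b : int) : 'cV[int]_2 := \col_i (if i == ord0 then a else b).

Definition Lambda := {i : 'cV[int]_2 | i != 0}.

Definition W := {freeg Lambda / int}.

(* W[q] = W (x) Z[q] is the free Z[q]-module on Lambda; q is 'X : {poly int}. *)
Definition Wq := {freeg Lambda / {poly int}}.

HB.instance Definition _ := GRing.Zmodule.on W.
HB.instance Definition _ := GRing.Lmodule.on Wq.

(* e_ i is the basis vector, with e_ 0 = 0 *)
Definition e_ (i : 'cV[int]_2) : Wq :=
  if insub i is Some k then << (k : Lambda) >> else 0.

Definition W_to_Wq (w : W) : Wq :=
  \sum_(k <- dom w) << (coeff k w)%:P *g k >>.

Definition Gamma_act (g : SL2Z) : Wq -> Wq :=
  fglift (fun k : Lambda => e_ (val g *m val k)).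

HB.instance Definition _ g := GRing.isZmodMorphism.Build Wq Wq (Gamma_act g)
  (lift_is_additive _).
HB.instance Definition _ g := GRing.isScalable.Build _ Wq Wq _ (Gamma_act g)
  (fglift_scalable _).

Definition mu : Wq -> Wq :=
  fglift (fun k : Lambda =>
    let x := val k ord0 ord0 in
    let y := val k ord_max ord0 in
    if 0 < y then e_ (pt x y) + ((1 - 'X) * y%:P) *: e_ (pt (-1) 0)
    else if y < 0 then e_ (pt (x - y) y) - ('X * y%:P) *: e_ (pt (-1) 0)
    else e_ (pt (x - 1) 0) - e_ (pt (-1) 0)).

HB.instance Definition _ := GRing.isZmodMorphism.Build Wq Wq mu
  (lift_is_additive _).
HB.instance Definition _ := GRing.isScalable.Build _ Wq Wq _ mu
  (fglift_scalable _).

Definition momentum : W -> 'cV[int]_2 := fglift (fun k : Lambda => val k).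

HB.instance Definition _ := GRing.isZmodMorphism.Build W 'cV[int]_2 momentum
  (lift_is_additive _).

Definition V_pred : {pred W} := fun w => momentum w == 0.

Fact V_zmod_closed : zmod_closed V_pred.
Proof.
split=> [|u v]; rewrite !unfold_in /V_pred ?raddf0 //.
have -> : momentum (u - v) = momentum u - momentum v by rewrite raddfB.
by move=> /eqP-> /eqP->; rewrite subr0.
Qed.

HB.instance Definition _ := GRing.isZmodClosed.Build W V_pred V_zmod_closed.

Record V := MkV { V_W :> W; _ : V_W \in V_pred }.
HB.instance Definition _ := [isSub for V_W].
HB.instance Definition _ := [Choice of V by <:].
HB.instance Definition _ := [SubChoice_isSubZmodule of V by <:].

Definition V_to_Wq (v : V) : Wq := W_to_Wq (val v).

Definition mx22 (a b c d : int) : 'M[int]_2 :=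
  \matrix_(i, j) if i == ord0 then (if j == ord0 then a else b)
                 else (if j == ord0 then c else d).

Fact det_I : \det (mx22 0 (-1) 1 0) == 1.
Proof.
by rewrite (expand_det_row _ ord0) !big_ord_recl big_ord0 /cofactor !det_mx11 !mxE.
Qed.

Definition SL2Z_I : SL2Z := MkSL2Z det_I.

Lemma IP_mapE (R : realType) :
  birat_map (birmono R SL2Z_I * birP R)%g = (Kx R / (1 + Ky R), Ky R).
Proof.
have dP := @birat_dominant R (birP R); rewrite -[birat_map _]/(P_map R) in dP.
apply: (@value_ratcomp _ (mono R (val SL2Z_I)) (P_map R)) => //=.
  rewrite /= !mxE /= expr0z mul1r -[X in has_value _ _ X]invf_div.
  apply: (@has_valueXz _ _ _ _ (-1)).
    rewrite mulf_neq0 ?invr_eq0 ?Kx_neq0 //.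
    exact: (add1X_neq0 R ord_max).
  exact: (has_value_coord _ ord_max).
rewrite /= !mxE /= expr0z mulr1 expr1z.
exact: (has_value_coord _ ord0).
Qed.

(* Main.v *)
From HB Require Import structures.
Require Import Defs.
From mathcomp Require Import all_boot all_order all_algebra.
From mathcomp Require Import fraction mpoly freeg complex.
From mathcomp Require Import boolp reals ring lra zify.

Set Implicit Arguments.
Unset Strict Implicit.
Unset Printing Implicit Defensive.

Import Order.TTheory GRing.Theory Num.Theory.
Local Open Scope ring_scope.

(** The idea is to let H act on a surface instead of on words in generators.
   Glue to the torus T = (C^* )^2, for every nonzero lattice vector i, the open
   part of an exceptional divisor: if i = n i' with i' primitive and n > 0, this
   is the last divisor obtained by blowing up n times, always on the boundary,
   the point of the toric divisor of i' where a primitive monomial equals -1.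
   Every element of H permutes the prime divisors of the resulting surface,
   which are these special divisors and the curves of T.  A finite combination
   of the special divisors belongs to V exactly when it kills all monomials,
   that is when it extends to a homomorphism from the divisor class group to Z.
   Hence V consists of such homomorphisms and H acts on it by transport of
   structure; only the formula for the map IP has to be compared with mu.

   Divisors are handled through their valuations on the function field K.  The
   valuation of the special divisor of i is characterised as the least one,
   on Laurent polynomials, among the valuations with prescribed values on
   monomials and positive value on 1 + z for suitable monomials z
   ([special_min]).  It is therefore unique, permuted by SL(2,Z)
   ([special_min_toric]), and permuted by IP when i is not on the horizontal axis
   ([special_min_mutation]); for i on this axis an explicit chart shows that IP
   shifts the valuations by one step, through the curve 1 + y = 0
   ([axis_val_ip]).

   An element w of V has a coordinate along each divisor ([has_coord]): along a
   special one, its coefficient; along a curve f = 0, minus the combination of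
   the special valuations of f given by w.  This number is well defined because
   the units of the ring of Laurent polynomials are monomials
   ([laurent_unit], [has_coord_uniq]).  The operators of SL(2,Z) and mu
   transport these coordinates ([transports_gam], [transports_ip]); in the
   second case the two correction terms of mu record that IP exchanges special
   divisors with the curve 1 + y = 0 ([lam_mut]).  Since an element of V is
   determined by its coordinates, the operator attached to a word in the
   generators depends only on the birational map that the word represents
   ([realizes_uniq]), and the homomorphism rho follows.  On W the map mu depends
   on q only through the momentum, hence not on V ([mu_W]), and the argument
   uses q = 1. *)

(** * The lattice W and its operators *)

Lemma W_ind (P : W -> Prop) : P 0 -> (forall l, P << l >>) ->
  (forall w w', P w -> P w' -> P (w - w')) -> forall w, P w.
Proof.
move=> P0 PU PB; have PN w : P w -> P (- w) by rewrite -[- w]sub0r; apply: PB.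
have PD w w' : P w -> P w' -> P (w + w').
  by move=> Pw Pw'; rewrite -[w']opprK; apply/PB/PN.
move=> w; rewrite -[w]freeg_sumE; apply: (big_ind P) => // l _.
have -> : << coeff l w *g l >> = << l >> *~ coeff l w :> W by rewrite freegU_mulz intz.
have Pn n : P (<< l >> *+ n) by elim: n => [|n IHn]; rewrite ?mulr0n // mulrS; apply: PD.
by case: (coeff l w) => n; [exact: Pn | rewrite NegzE mulrNz; apply/PN/Pn].
Qed.

Definition W_ext (M : lmodType int) (f : Lambda -> M) : W -> M := fglift f.

HB.instance Definition _ (M : lmodType int) (f : Lambda -> M) :=
  GRing.isZmodMorphism.Build W M (W_ext f) (lift_is_additive f).

Lemma W_extU (M : lmodType int) (f : Lambda -> M) l : W_ext f << l >> = f l.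
Proof. by rewrite /W_ext liftU scale1r. Qed.

HB.instance Definition _ (l : Lambda) := GRing.isZmodMorphism.Build W int (coeff l)
  (coeff_is_additive l).

Lemma coeff_basis (l l' : Lambda) : coeff l (<< l' >> : W) = (l' == l)%:R.
Proof. by rewrite coeffU mul1r. Qed.

Lemma momentumU l : momentum << l >> = val l.
Proof. by rewrite /momentum liftU scale1r. Qed.

Definition w_ (i : 'cV[int]_2) : W :=
  if insub i is Some l then << (l : Lambda) >> else 0.

Lemma w_val (l : Lambda) : w_ (val l) = << l >>.
Proof. by rewrite /w_ valK. Qed.

Lemma momentum_w i : momentum (w_ i) = i.
Proof.
rewrite /w_; case: insubP => [l _ <-|]; first exact: momentumU.
by rewrite negbK => /eqP ->; rewrite raddf0.
Qed.

Lemma coeff_w (l : Lambda) i : coeff l (w_ i) = (i == val l)%:R.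
Proof.
rewrite /w_; case: insubP => [l' _ <-|]; first by rewrite coeff_basis (inj_eq val_inj).
by rewrite negbK => /eqP ->; rewrite raddf0 eq_sym (negPf (valP l)).
Qed.

Definition gam_W (g : SL2Z) : W -> W := W_ext (fun l => w_ (val g *m val l)).

HB.instance Definition _ g := GRing.isZmodMorphism.Build W W (gam_W g)
  (lift_is_additive _).

Lemma gam_WU g l : gam_W g << l >> = w_ (val g *m val l).
Proof. exact: W_extU. Qed.

Lemma momentum_gam g w : momentum (gam_W g w) = val g *m momentum w.
Proof.
elim/W_ind: w => [|l|w w' IHw IHw']; first by rewrite !raddf0.
  by rewrite gam_WU momentum_w momentumU.
by rewrite !raddfB /= IHw IHw'.
Qed.

(** The value of 1 + y along the special divisor of i. *)
Definition beta (i : 'cV[int]_2) : int :=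
  if i ord_max ord0 == 0 then 1 else Num.min 0 (i ord_max ord0).

Definition mut_pt (i : 'cV[int]_2) := pt (i ord0 ord0 - beta i) (i ord_max ord0).

Definition pt_left : 'cV[int]_2 := pt (-1) 0.

(** The specialisation of the map mu at q = 1. *)
Definition mut_W : W -> W :=
  W_ext (fun l => w_ (mut_pt (val l)) - w_ pt_left *~ beta (val l)).

HB.instance Definition _ := GRing.isZmodMorphism.Build W W mut_W
  (lift_is_additive _).

Lemma mut_WU l : mut_W << l >> = w_ (mut_pt (val l)) - w_ pt_left *~ beta (val l).
Proof. exact: W_extU. Qed.

Lemma ord2P (i : 'I_2) : i = ord0 \/ i = ord_max.
Proof. by case: i => [[|[|[]]]] // h; [left | right]; apply: val_inj. Qed.

Lemma cV2_eq (i j : 'cV[int]_2) :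
  i ord0 ord0 = j ord0 ord0 -> i ord_max ord0 = j ord_max ord0 -> i = j.
Proof. by move=> e0 e1; apply/matrixP => a b; rewrite ord1; case: (ord2P a) => ->. Qed.

Lemma det2 (M : 'M[int]_2) :
  \det M = M ord0 ord0 * M ord_max ord_max - M ord0 ord_max * M ord_max ord0.
Proof.
rewrite (expand_det_row _ ord0) !big_ord_recl big_ord0 /cofactor !det_mx11 !mxE /=.
rewrite expr0 expr1 mul1r mulN1r addr0 mulrN.
by congr (M _ _ * M _ _ - M _ _ * M _ _); apply: val_inj.
Qed.

Lemma pt0 a b : pt a b ord0 ord0 = a. Proof. by rewrite mxE. Qed.
Lemma pt1 a b : pt a b ord_max ord0 = b. Proof. by rewrite mxE. Qed.

Lemma momentum_mut w : momentum (mut_W w) = momentum w.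
Proof.
elim/W_ind: w => [|l|w w' IHw IHw']; first by rewrite !raddf0.
  rewrite mut_WU raddfB raddfMz /= !momentum_w momentumU -scaler_int intz.
  by apply: cV2_eq; rewrite !mxE /=; ring.
by rewrite !raddfB /= IHw IHw'.
Qed.

(** ** Comparison with W[q] *)

Lemma coeff_W_to_Wq k w : coeff k (W_to_Wq w) = (coeff k w)%:P.
Proof.
rewrite /W_to_Wq raddf_sum /=.
have [kw|kw] := boolP (k \in dom w).
  rewrite (bigD1_seq k) ?uniq_dom //= coeffU eqxx mulr1 big1 ?addr0 // => l lk.
  by rewrite coeffU (negPf lk) mulr0.
rewrite (coeff_outdom kw) big_seq big1 // => l lw; rewrite coeffU.
by case: eqP kw lw => [->/negPf->//|]; rewrite mulr0.
Qed.

Fact W_to_Wq_zmod_morphism : zmod_morphism W_to_Wq.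
Proof.
move=> w w'; apply/eqP/freeg_eqP => k.
by rewrite coeffB !coeff_W_to_Wq coeffB polyCB.
Qed.

HB.instance Definition _ := GRing.isZmodMorphism.Build W Wq W_to_Wq
  W_to_Wq_zmod_morphism.

Lemma W_to_Wq_w i : W_to_Wq (w_ i) = e_ i.
Proof.
rewrite /w_ /e_; case: insubP => [l _ _|_]; last exact: raddf0.
by apply/eqP/freeg_eqP => k; rewrite coeff_W_to_Wq !coeffU !mul1r; case: eqP.
Qed.

Lemma W_to_WqU l : W_to_Wq << l >> = << l >>.
Proof. by rewrite -w_val W_to_Wq_w /e_ valK. Qed.

Lemma Gamma_act_W g w : Gamma_act g (W_to_Wq w) = W_to_Wq (gam_W g w).
Proof.
elim/W_ind: w => [|l|w w' IHw IHw']; first by rewrite !raddf0.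
  by rewrite gam_WU W_to_Wq_w W_to_WqU /Gamma_act liftU scale1r.
by rewrite !raddfB /= IHw IHw'.
Qed.

(** On W the operator mu depends on q only through the second coordinate of
   the momentum, so that this dependence disappears on V. *)
Lemma mu_W w : mu (W_to_Wq w) = W_to_Wq (mut_W w) +
  ((1 - 'X) * (momentum w ord_max ord0)%:P) *: e_ pt_left.
Proof.
elim/W_ind: w => [|l|w w' IHw IHw'].
- by rewrite !raddf0 mxE polyC0 mulr0 scale0r addr0.
- rewrite mut_WU raddfB raddfMz /= !W_to_Wq_w W_to_WqU momentumU /mu liftU scale1r.
  rewrite -scaler_int /mut_pt /beta /pt_left.
  set a := \val l ord0 ord0; set b := \val l ord_max ord0.
  have -> (z : int) : z%:~R = z%:P :> {poly int} by rewrite -[in RHS](intz z) rmorph_int.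
  rewrite -addrA; case: (ltrgt0P b) => [bp|bn|->].
  + by rewrite subr0 polyC0 scale0r oppr0 add0r.
  + rewrite -!scaleNr -scalerDl; congr (_ + _ *: _).
    by rewrite mulrBl mul1r addKr.
  by rewrite polyC0 mulr0 scale0r addr0 scale1r.
rewrite !raddfB /= IHw IHw' !mxE polyCB mulrBr scalerBl.
by rewrite opprD addrACA.
Qed.

(** * Valuations of a field over a field of constants *)

Section Valuations.
Variables (k K : fieldType) (cst : {rmorphism k -> K}).
Implicit Types (nu : K -> int) (f g : K) (n m : int).

(** Zero counts as having infinite value in [vge], while the record [valuation]
   fixes the junk value of nu at 0, so that equal valuations are equal
   functions. *)
Definition vge nu n f := (f == 0) || (n <= nu f).

Record valuation nu : Prop := Valuation {
  val0 : nu 0 = 0;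
  valM : forall f g, f != 0 -> g != 0 -> nu (f * g) = nu f + nu g;
  vgeD : forall n f g, vge nu n f -> vge nu n g -> vge nu n (f + g);
  val_cst : forall c, nu (cst c) = 0 }.

Section Theory.
Variable nu : K -> int.
Hypothesis nuP : valuation nu.

Lemma val1 : nu 1 = 0. Proof. by rewrite -(rmorph1 cst) val_cst. Qed.

Lemma valN f : nu (- f) = nu f.
Proof.
have [->|f0] := eqVneq f 0; first by rewrite oppr0.
by rewrite -mulN1r valM // ?oppr_eq0 ?oner_eq0 // -(rmorph1 cst) -rmorphN val_cst // add0r.
Qed.

Lemma valV f : nu f^-1 = - nu f.
Proof.
have [->|f0] := eqVneq f 0; first by rewrite invr0 val0.
by apply/eqP; rewrite -addr_eq0 -valM ?invr_eq0 // mulVf // val1.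
Qed.

Lemma valXn f i : nu (f ^+ i) = i%:Z * nu f.
Proof.
have [->|f0] := eqVneq f 0.
  by rewrite expr0n val0 // mulr0; case: i => [|i]; rewrite ?val1 ?val0.
elim: i => [|i IHi]; first by rewrite val1 mul0r.
by rewrite exprS valM ?expf_neq0 // IHi intS mulrDl mul1r.
Qed.

Lemma valXz f n : nu (f ^ n) = n * nu f.
Proof.
case: n => i; first exact: valXn.
by rewrite NegzE -exprnN valV valXn mulNr.
Qed.

Lemma val_monomial f g n m : f != 0 -> g != 0 ->
  nu (f ^ n * g ^ m) = n * nu f + m * nu g.
Proof. by move=> f0 g0; rewrite valM ?expfz_neq0 // !valXz. Qed.

Lemma vgeM n m f g : vge nu n f -> vge nu m g -> vge nu (n + m) (f * g).
Proof.
rewrite /vge mulf_eq0; have [//|f0] := eqVneq f 0; have [//|g0] := eqVneq g 0.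
by rewrite valM //= => ? ?; apply: lerD.
Qed.

Lemma vgeXn n f i : vge nu n f -> vge nu (i%:Z * n) (f ^+ i).
Proof.
move=> nf; elim: i => [|i IHi]; first by rewrite mul0r expr0 /vge val1 lexx orbT.
by rewrite exprS intS mulrDl mul1r; apply: vgeM.
Qed.

Lemma vge_cst c : vge nu 0 (cst c).
Proof. by rewrite /vge val_cst // lexx orbT. Qed.

Lemma vge_refl f : vge nu (nu f) f. Proof. by rewrite /vge lexx orbT. Qed.

Lemma vgeW n m f : n <= m -> vge nu m f -> vge nu n f.
Proof. by rewrite /vge => nm /orP[->//|/(le_trans nm)->]; rewrite orbT. Qed.

Lemma vgeN n f : vge nu n (- f) = vge nu n f.
Proof. by rewrite /vge oppr_eq0 valN. Qed.

Lemma vge_sum (I : eqType) (s : seq I) (F : I -> K) n :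
  (forall i, i \in s -> vge nu n (F i)) -> vge nu n (\sum_(i <- s) F i).
Proof.
move=> sF; rewrite big_seq; apply: (big_ind (fun f => vge nu n f)) => [|f g|//].
  by rewrite /vge eqxx.
exact: (vgeD nuP).
Qed.

Lemma val_ge n f : f != 0 -> vge nu n f -> n <= nu f.
Proof. by move=> /negPf f0; rewrite /vge f0. Qed.

(** The equality case of the ultrametric inequality. *)
Lemma valD_dominant f g : f != 0 -> vge nu (nu f + 1) g ->
  f + g != 0 /\ nu (f + g) = nu f.
Proof.
move=> f0 hg; have fg0 : f + g != 0.
  apply/eqP => /eqP; rewrite addrC addr_eq0 => /eqP gE; move: hg.
  by rewrite gE vgeN /vge (negPf f0) /= gerDl.
split=> //; apply/eqP; rewrite eq_le; apply/andP; split; last first.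
  apply: (val_ge fg0); apply: (vgeD nuP); first exact: vge_refl.
  by apply: vgeW hg; rewrite lerDl.
rewrite leNgt; apply/negP => lt1.
have : vge nu (nu f + 1) ((f + g) - g).
  by apply: (vgeD nuP); rewrite ?vgeN // /vge (negPf fg0) /= lezD1.
by rewrite addrK /vge (negPf f0) /= gerDl.
Qed.

Lemma val_pullback (s : {rmorphism K -> K}) :
  (forall c, s (cst c) = cst c) -> valuation (nu \o s).
Proof.
move=> sc; split=> [|f g f0 g0|n f g|c] /=.
- by rewrite rmorph0 val0.
- by rewrite rmorphM valM ?fmorph_eq0.
- by have:= @vgeD _ nuP n (s f) (s g); rewrite /vge -rmorphD /= !fmorph_eq0.
- by rewrite sc val_cst.
Qed.

End Theory.
End Valuations.

(** * Fraction fields of polynomial rings in two variables *)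

Lemma add_fracMl (F : fieldType) (t a b a' b' : F) : b != 0 -> b' != 0 ->
  a / b + t * (a' / b') = (a * b' + t * (a' * b)) / (b * b').
Proof. by move=> b0 b'0; field; rewrite b0 b'0. Qed.

Lemma div_mul_cancel (F : fieldType) (g a b c : F) : c != 0 ->
  g / (a * b) = g * c / a * (c^-1 * b^-1).
Proof. by move=> c0; rewrite invfM mulrACA mulfK // -mulrA. Qed.

Lemma sub_bilinear (a a' b b' c c' s t : int) :
  (a - b * s - c * t) - (a' - b' * s - c' * t) =
  (a - a') - (b - b') * s - (c - c') * t.
Proof. by ring. Qed.

Lemma mpoly2_ind (k : fieldType) (P : {mpoly k[2]} -> Prop) :
    (forall c, P c%:MP) -> P 'X_ord0 -> P 'X_ord_max ->
    (forall p q, P p -> P q -> P (p + q)) ->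
    (forall p q, P p -> P q -> P (p * q)) -> forall p, P p.
Proof.
move=> Pc PX PY PD PM; elim/mpolyind => [|c m p _ _ Pp]; first by rewrite -mpolyC0.
apply: PD Pp; rewrite -mul_mpolyC; apply: (PM) => //; rewrite mpolyXE_id.
have P1 : P 1 by rewrite -mpolyC1.
apply: (big_ind P) => // i _.
have PXi : P 'X_i by case: (ord2P i) => ->.
by elim: (m i) => [|n IHn]; rewrite ?expr0 // exprS; apply: PM.
Qed.

(** The function field is abstract until the end, as a field of fractions of
   k[x, y]; its birational transformations enter as endomorphisms. *)
Section FractionField.
Variables (k K : fieldType) (iota : {rmorphism {mpoly k[2]} -> K}).
Hypothesis iota_inj : injective iota.
Hypothesis iota_frac : forall f,
  exists p q : {mpoly k[2]}, q != 0 /\ f = iota p / iota q.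

Local Notation X := ('X_ord0 : {mpoly k[2]}).
Local Notation Y := ('X_ord_max : {mpoly k[2]}).
Local Notation x := (iota X).
Local Notation y := (iota Y).
Local Notation cst := (iota \o @mpolyC 2 k : {rmorphism k -> K}).
Implicit Types (f g : K) (p q : {mpoly k[2]}).

Definition ev (u v : K) : {rmorphism {mpoly k[2]} -> K} :=
  mmap cst (fun i => if i == ord0 then u else v).

Lemma evC u v c : ev u v c%:MP = iota c%:MP.
Proof. exact: mmapC. Qed.

Lemma evX u v : ev u v X = u.
Proof. by rewrite /ev /= mmapX mmap1U. Qed.

Lemma evY u v : ev u v Y = v.
Proof. by rewrite /ev /= mmapX mmap1U. Qed.

Lemma iota_eq0 p : (iota p == 0) = (p == 0).
Proof. by rewrite -(inj_eq iota_inj) rmorph0. Qed.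

Lemma varX_neq0 : X != 0 :> {mpoly k[2]}.
Proof. by rewrite -msize_poly_eq0 msizeX. Qed.

Lemma varY_neq0 : Y != 0 :> {mpoly k[2]}.
Proof. by rewrite -msize_poly_eq0 msizeX. Qed.

Lemma x_neq0 : x != 0. Proof. by rewrite iota_eq0 varX_neq0. Qed.
Lemma y_neq0 : y != 0. Proof. by rewrite iota_eq0 varY_neq0. Qed.

Lemma rmorph_ev (s : {rmorphism K -> K}) u v p : (forall c, s (cst c) = cst c) ->
  s (ev u v p) = ev (s u) (s v) p.
Proof.
move=> sc; elim/mpoly2_ind: p => [c|||p q IHp IHq|p q IHp IHq].
- by rewrite !evC; exact: sc.
- by rewrite !evX.
- by rewrite !evY.
- by rewrite !rmorphD IHp IHq.
- by rewrite !rmorphM IHp IHq.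
Qed.

Lemma ev_xy p : ev x y p = iota p.
Proof.
elim/mpoly2_ind: p => [c|||p q IHp IHq|p q IHp IHq]; rewrite ?evC ?evX ?evY //.
- by rewrite !rmorphD IHp IHq.
- by rewrite !rmorphM IHp IHq.
Qed.

(** ** The order along the axis y = 0 *)

Local Notation ev0 := (ev x 0).

Lemma ev0_decomp p : exists q, iota p = y * iota q + ev0 p.
Proof.
elim/mpoly2_ind: p => [c|||p q [a pE] [b qE]|p q [a pE] [b qE]].
- by exists 0; rewrite rmorph0 mulr0 add0r evC.
- by exists 0; rewrite rmorph0 mulr0 add0r ?evX ?evY.
- by exists 1; rewrite rmorph1 mulr1 evY /= addr0.
- by exists (a + b); rewrite !rmorphD /= pE qE mulrDr addrACA.
exists (a * q + (p - Y * a) * b).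
rewrite !(rmorphM, rmorphD, rmorphN) /=.
have [-> ->] : ev0 p = iota p - y * iota a /\ ev0 q = iota q - y * iota b.
  by rewrite pE qE; split; rewrite addrC addKr.
by ring.
Qed.

Lemma ev0_dvd p : ev0 p = 0 -> exists q, p = Y * q.
Proof.
have [q pE] := ev0_decomp p => p0; exists q.
by apply: iota_inj; rewrite rmorphM pE p0 addr0.
Qed.

Lemma mpoly_split p : p != 0 -> exists n q, ev0 q != 0 /\ p = Y ^+ n * q.
Proof.
move: {2}(msize p) (leqnn (msize p)) => s; elim: s p => [|s IHs] p ps p0.
  by move: ps; rewrite leqn0 msize_poly_eq0 (negPf p0).
have [/ev0_dvd[q pE]|e0] := eqVneq (ev0 p) 0; last by exists 0%N, p; rewrite mul1r.
have q0 : q != 0 by apply: contraNneq p0 => q0; rewrite pE q0 mulr0.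
have [|//|n [r [r0 qE]]] := IHs q.
  by move: ps; rewrite pE msizeM ?varY_neq0 // msizeX mdeg1.
by exists n.+1, r; split=> //; rewrite pE {1}qE exprS mulrA.
Qed.

(** Being prime to y is expressed as a nonzero value at y = 0. *)
Definition is_ord_y f n := exists p q,
  [/\ ev0 p != 0, ev0 q != 0 & f = y ^ n * (iota p / iota q)].

Let ev0_nz p : ev0 p != 0 -> iota p != 0 :> K.
Proof. by move=> p0; rewrite iota_eq0; apply: contraNneq p0 => ->; rewrite rmorph0. Qed.

Let y0 : y != 0 := y_neq0.

Lemma is_ord_y_ex f : f != 0 -> exists n, is_ord_y f n.
Proof.
move=> f0; have [p [q [q0 fE]]] := iota_frac f; have p0 : p != 0.
  by apply: contraNneq f0 => p0; rewrite fE p0 rmorph0 mul0r.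
have [i [p1 [p10 pE]]] := mpoly_split p0; have [j [q1 [q10 qE]]] := mpoly_split q0.
exists (i%:Z - j%:Z), p1, q1; split=> //.
by rewrite fE pE qE !rmorphM !rmorphXn expfzDr // -mulf_div -exprnN.
Qed.

Lemma is_ord_y_uniq f n m : is_ord_y f n -> is_ord_y f m -> n = m.
Proof.
wlog nm : n m / n <= m => [hw|] hn hm.
  by have /orP[nm|mn] := le_total n m; [exact: hw | exact/esym/hw].
move: hn hm => [p [q [p0 q0 ->]]] [p' [q' [p'0 q'0 e]]].
have [//|nm'] := eqVneq n m; exfalso.
have /ltW : n < m by rewrite lt_neqAle nm'.
rewrite -subr_ge0 => d0; have /gez0_abs := d0; case: `|m - n|%N (nm') => [|d] nm1 dE.
  by move/eqP: dE; rewrite eq_sym subr_eq0 eq_sym (negPf nm').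
have e1 : p * q' = Y ^+ d.+1 * (p' * q).
  apply: iota_inj; rewrite !rmorphM rmorphXn /=.
  have -> : y ^+ d.+1 = y ^ (m - n) by rewrite -dE.
  apply: (mulfI (expfz_neq0 n y0)).
  rewrite [RHS]mulrA -expfzDr // [n + _]addrC subrK mulrA.
  have q1 := ev0_nz q0; have q'1 := ev0_nz q'0.
  rewrite -[y ^ n * _](divfK q1) -[y ^ n * iota p / _]mulrA e.
  by field.
have : ev0 (p * q') = 0 by rewrite e1 rmorphM rmorphXn ?evX ?evY /= exprS !mul0r.
by apply/eqP; rewrite rmorphM mulf_neq0.
Qed.

Definition ord_y f : int :=
  if pselect (exists n, is_ord_y f n) is left e then sval (cid e) else 0.

Lemma ord_yE f n : is_ord_y f n -> ord_y f = n.
Proof.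
move=> fn; rewrite /ord_y; case: pselect => [e|[]]; last by exists n.
by case: cid => m /= /is_ord_y_uniq; apply.
Qed.

Lemma ord_yP f : f != 0 -> is_ord_y f (ord_y f).
Proof. by move=> /is_ord_y_ex[n fn]; rewrite (ord_yE fn). Qed.

Lemma ord_y0 : ord_y 0 = 0.
Proof.
rewrite /ord_y; case: pselect => // e; have [n [p [q [p0 q0 /eqP]]]] := e.
rewrite eq_sym !mulf_eq0 invr_eq0 (negPf (expfz_neq0 n y0)).
by rewrite (negPf (ev0_nz p0)) (negPf (ev0_nz q0)).
Qed.

Lemma ord_y_poly p : p != 0 -> exists n q, p = Y ^+ n * q /\ ord_y (iota p) = n.
Proof.
move=> /mpoly_split[n [q [q0 pE]]]; exists n, q; split=> //.
apply: ord_yE; exists q, 1; rewrite rmorph1 oner_neq0; split=> //.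
by rewrite rmorph1 divr1 pE rmorphM rmorphXn.
Qed.

Lemma vge_ord_y_poly p : vge ord_y 0 (iota p).
Proof.
rewrite /vge iota_eq0; have [//|/ord_y_poly[n [q [_ ->]]]] := eqVneq p 0.
by rewrite le0z_nat.
Qed.

Lemma ord_y_dvd p n : vge ord_y n%:Z (iota p) -> exists q, p = Y ^+ n * q.
Proof.
rewrite /vge iota_eq0; have [->|/ord_y_poly[m [q [pE ->]]]] /= := eqVneq p 0.
  by exists 0; rewrite mulr0.
rewrite lez_nat => /subnKC nm; exists (Y ^+ (m - n) * q).
by rewrite mulrA -exprD nm.
Qed.

Lemma ord_yM f g : f != 0 -> g != 0 -> ord_y (f * g) = ord_y f + ord_y g.
Proof.
move=> /ord_yP[p [q [p0 q0 fE]]] /ord_yP[p' [q' [p'0 q'0 gE]]].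
apply: ord_yE; exists (p * p'), (q * q'); rewrite !rmorphM !mulf_neq0 //; split=> //.
by rewrite {1}fE {1}gE mulrACA -expfzDr // mulf_div.
Qed.

Lemma ord_y_y : ord_y y = 1.
Proof.
apply: ord_yE; exists 1, 1; rewrite !rmorph1 !oner_neq0; split=> //.
by rewrite ?rmorph1 divr1 mulr1 expr1z.
Qed.

Lemma ord_y_ev0 p : ev0 p != 0 -> ord_y (iota p) = 0.
Proof.
move=> p0; apply: ord_yE; exists p, 1; rewrite rmorph1 oner_neq0; split=> //.
by rewrite ?rmorph1 divr1 mul1r.
Qed.

Lemma ord_y_valuation : valuation cst ord_y.
Proof.
split.
- exact: ord_y0.
- exact: ord_yM.
- move=> n f g; have [->|f0] := eqVneq f 0; first by rewrite add0r.
  have [->|g0] := eqVneq g 0; first by rewrite addr0.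
  rewrite /vge (negPf f0) (negPf g0) /=.
  wlog fg : f g f0 g0 / ord_y f <= ord_y g => [hw nf ng|nf _].
    have /orP[fg|gf] := le_total (ord_y f) (ord_y g); first exact: hw.
    by rewrite addrC; apply: hw.
  have [->//|fg0] := eqVneq (f + g) 0; apply: le_trans nf _.
  have [p [q [p0 q0 fE]]] := ord_yP f0; have [p' [q' [p'0 q'0 gE]]] := ord_yP g0.
  move: fg; rewrite -subr_ge0 => /gez0_abs; move: `|_|%N => d dE.
  pose a := p * q' + Y ^+ d * (p' * q).
  have sE : f + g = y ^ ord_y f * (iota a / iota (q * q')).
    have gE' : g = y ^ ord_y f * (y ^+ d * (iota p' / iota q')).
      by rewrite {1}gE -[ord_y g](addrNK (ord_y f)) -dE addrC expfzDr // -mulrA.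
    rewrite {1}fE {1}gE' -mulrDr /a rmorphD !rmorphM rmorphXn.
    by rewrite add_fracMl // ev0_nz.
  have a0 : a != 0.
    by apply: contraNneq fg0 => a0; rewrite sE a0 rmorph0 mul0r mulr0.
  have yz n' : y ^ n' != 0 by apply: expfz_neq0.
  have qq0 : iota (q * q') != 0 :> K by rewrite rmorphM mulf_neq0 ?ev0_nz.
  have ia0 : iota a != 0 by rewrite iota_eq0.
  have iq0 : (iota (q * q'))^-1 != 0 by rewrite invr_eq0.
  rewrite sE (ord_yM (yz _) (mulf_neq0 ia0 iq0)) (ord_yM ia0 iq0).
  rewrite (@ord_yE (y ^ _) (ord_y f)); last first.
    by exists 1, 1; rewrite !rmorph1 oner_neq0 ?rmorph1 divr1 mulr1.
  rewrite (@ord_yE _^-1 0) ?addr0 ?lerDl.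
    by have := vge_ord_y_poly a; rewrite /vge iota_eq0 (negPf a0).
  exists 1, (q * q'); rewrite rmorph1 oner_neq0 rmorphM mulf_neq0 //.
  by rewrite expr0z mul1r ?rmorph1 mul1r.
move=> c; have [->|c0] := eqVneq c 0.
  by rewrite rmorph0 ord_y0.
by apply: ord_y_ev0; rewrite evC iota_eq0 mpolyC_eq0.
Qed.


(** * Laurent polynomials *)

Inductive laurent : K -> Prop :=
| laurent_cst c : laurent (cst c)
| laurent_monomial (n m : int) : laurent (x ^ n * y ^ m)
| laurentD f g : laurent f -> laurent g -> laurent (f + g)
| laurentM f g : laurent f -> laurent g -> laurent (f * g).

Lemma laurent1 : laurent 1.
Proof. by rewrite -(rmorph1 cst); apply: laurent_cst. Qed.

Lemma laurent_x : laurent x.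
Proof. by have := laurent_monomial 1 0; rewrite expr1z expr0z mulr1. Qed.

Lemma laurent_y : laurent y.
Proof. by have := laurent_monomial 0 1; rewrite expr1z expr0z mul1r. Qed.

Lemma laurentX f n : laurent f -> laurent (f ^+ n).
Proof.
move=> lf; elim: n => [|n IHn]; first exact: laurent1.
by rewrite exprS; apply: laurentM.
Qed.

Lemma laurent_ev u v p : laurent u -> laurent v -> laurent (ev u v p).
Proof.
move=> lu lv; elim/mpoly2_ind: p => [c|||p q IHp IHq|p q IHp IHq].
- by rewrite evC; apply: (laurent_cst c).
- by rewrite evX.
- by rewrite evY.
- by rewrite rmorphD; apply: laurentD.
- by rewrite rmorphM; apply: laurentM.
Qed.

Lemma laurent_poly p : laurent (iota p).
Proof. by rewrite -ev_xy; apply: laurent_ev; [exact: laurent_x | exact: laurent_y]. Qed.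

Lemma laurent_clear f : laurent f -> exists n p, f * (x * y) ^+ n = iota p.
Proof.
elim=> [c|n m|{}f g _ [n [p fE]] _ [m [q gE]]|{}f g _ [n [p fE]] _ [m [q gE]]].
- by exists 0%N, c%:MP; rewrite mulr1.
- pose N := (absz n + absz m)%N.
  exists N, (X ^+ absz (n + N%:Z) * Y ^+ absz (m + N%:Z)).
  rewrite exprMn mulrACA -[x ^+ _]/(x ^ Posz _) -[y ^+ _]/(y ^ Posz _).
  rewrite -!expfzDr ?x_neq0 ?y_neq0 // rmorphM !rmorphXn /=.
  by congr (_ * _); rewrite -[RHS]/(_ ^ Posz _) gez0_abs //; rewrite /N; lia.
- exists (n + m)%N, (p * (X * Y) ^+ m + q * (X * Y) ^+ n).
  rewrite rmorphD !rmorphM !rmorphXn !rmorphM /= -fE -gE exprD.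
  by ring.
exists (n + m)%N, (p * q); rewrite rmorphM -fE -gE exprD /=.
by ring.
Qed.

Lemma xy_neq0 n : (x * y) ^+ n != 0.
Proof. by rewrite expf_neq0 ?mulf_neq0 ?x_neq0 ?y_neq0. Qed.

Lemma laurent_xyV n : laurent ((x * y) ^- n).
Proof.
rewrite exprMn invfM.
by have := laurent_monomial (- n%:Z) (- n%:Z); rewrite -!exprnN.
Qed.

Lemma val_eq_laurent nu nu' : valuation cst nu -> valuation cst nu' ->
  (forall f, laurent f -> f != 0 -> nu f = nu' f) -> nu = nu'.
Proof.
move=> hn hn' e; apply/funext => f.
have [->|f0] := eqVneq f 0; first by rewrite (val0 hn) (val0 hn').
have [p [q [q0 fE]]] := iota_frac f; have p0 : p != 0.
  by apply: contraNneq f0 => p0; rewrite fE p0 rmorph0 mul0r.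
rewrite fE (valM hn) ?(valM hn') ?invr_eq0 ?iota_eq0 // (valV hn) (valV hn').
by rewrite !e ?iota_eq0 //; exact: laurent_poly.
Qed.

(** ** Units of the ring of Laurent polynomials *)

Lemma ord_y_x : ord_y x = 0.
Proof. by apply: ord_y_ev0; rewrite evX x_neq0. Qed.

(** The exchange of x and y turns the order along y = 0 into the order along
   x = 0. *)
Variable swap : {rmorphism K -> K}.
Hypothesis swap_cst : forall c, swap (cst c) = cst c.
Hypothesis swap_x : swap x = y.
Hypothesis swap_y : swap y = x.

Lemma swap_poly p : exists q, swap (iota p) = iota q /\ swap (iota q) = iota p.
Proof.
elim/mpoly2_ind: p => [c|||p q [p' [e1 e2]] [q' [e3 e4]]|p q [p' [e1 e2]] [q' [e3 e4]]].
- by exists c%:MP; split; apply: swap_cst.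
- by exists Y.
- by exists X.
- by exists (p' + q'); rewrite !rmorphD /= e1 e2 e3 e4.
- by exists (p' * q'); rewrite !rmorphM /= e1 e2 e3 e4.
Qed.

Definition ord_x : K -> int := ord_y \o swap.

Lemma ord_x_valuation : valuation cst ord_x.
Proof. exact: (val_pullback ord_y_valuation swap_cst). Qed.

Lemma ord_x_x : ord_x x = 1. Proof. by rewrite /ord_x /= swap_x ord_y_y. Qed.
Lemma ord_x_y : ord_x y = 0. Proof. by rewrite /ord_x /= swap_y ord_y_x. Qed.

(** The powers of x and y in a denominator are removed one after the other. *)
Lemma poly_of_laurent f : laurent f -> vge ord_x 0 f -> vge ord_y 0 f ->
  exists p, f = iota p.
Proof.
move=> /laurent_clear[n [p fE]] fx fy.
have vx := ord_x_valuation; have vy := ord_y_valuation.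
have [q pE] : exists q, p = Y ^+ n * q.
  apply: ord_y_dvd; rewrite -fE -[n%:Z]add0r; apply: (vgeM vy) => //.
  rewrite /vge (valXn vy) ord_yM ?x_neq0 ?y_neq0 // ord_y_x ord_y_y.
  by rewrite add0r mulr1 lexx orbT.
have qE : f * x ^+ n = iota q.
  apply: (mulIf (expf_neq0 n y_neq0)); rewrite -mulrA -exprMn fE pE rmorphM rmorphXn.
  by rewrite mulrC.
have [q' [e1 e2]] := swap_poly q; have [r' qE'] : exists r, q' = Y ^+ n * r.
  apply: ord_y_dvd; rewrite -e1 -qE -[n%:Z]add0r rmorphM; apply: (vgeM vy).
    by move: fx; rewrite /vge fmorph_eq0.
  by rewrite rmorphXn /= swap_x /vge (valXn vy) ord_y_y mulr1 lexx orbT.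
have [r [e3 e4]] := swap_poly r'; exists r.
apply: (mulIf (expf_neq0 n x_neq0)); rewrite qE -e2 qE' rmorphM !rmorphM !rmorphXn /=.
by rewrite swap_y e3 mulrC.
Qed.

(** After division by a monomial a unit has order 0 along both axes, and so has
   its inverse; both are then polynomials, hence constants. *)
Lemma laurent_unit u : laurent u -> laurent u^-1 -> u != 0 ->
  exists c (n m : int), [/\ c != 0 & u = cst c * (x ^ n * y ^ m)].
Proof.
move=> lu lv u0; have vx := ord_x_valuation; have vy := ord_y_valuation.
have [x0 y0'] := (x_neq0, y_neq0).
pose n := ord_x u; pose m := ord_y u; pose t := x ^ n * y ^ m.
have t0 : t != 0 by rewrite mulf_neq0 ?expfz_neq0.
have tV : t^-1 = x ^ (- n) * y ^ (- m) by rewrite invfM !invr_expz.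
have [tx ty] : ord_x t = n /\ ord_y t = m.
  rewrite (val_monomial vx) // (val_monomial vy) //.
  by rewrite ord_x_x ord_x_y ord_y_x ord_y_y !(mulr1, mulr0, addr0, add0r).
have w0 : u / t != 0 by rewrite mulf_neq0 ?invr_eq0.
have [wx wy] : ord_x (u / t) = 0 /\ ord_y (u / t) = 0.
  rewrite (valM vx) ?(valM vy) ?invr_eq0 // (valV vx) (valV vy) tx ty /n /m.
  by rewrite !subrr.
have [p pE] : exists p, u / t = iota p.
  apply: poly_of_laurent; rewrite /vge ?wx ?wy ?lexx ?orbT //.
  by apply: laurentM => //; rewrite tV; apply: laurent_monomial.
have [q qE] : exists q, (u / t)^-1 = iota q.
  apply: poly_of_laurent; rewrite /vge ?(valV vx) ?(valV vy) ?wx ?wy ?lexx ?orbT //.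
  by rewrite invf_div mulrC; apply: laurentM => //; apply: laurent_monomial.
have pq : p * q = 1 by apply: iota_inj; rewrite rmorphM -pE -qE mulfV // rmorph1.
have p0 : p != 0 by rewrite -iota_eq0 -pE.
have q0 : q != 0 by rewrite -iota_eq0 -qE invr_eq0.
have s1 : (msize p <= 1)%N.
  have := msizeM p0 q0; rewrite pq msize1; move: p0 q0.
  rewrite -!msize_poly_eq0; case: (msize p) (msize q) => [|a] [|b] //= _ _ e; lia.
exists p@_0, n, m; split.
  by apply: contraNneq p0 => e; rewrite (msize1_polyC s1) e mpolyC0.
rewrite -[LHS](divfK t0) pE (msize1_polyC s1); congr (iota _ * _).
by rewrite mcoeffC eqxx mulr1.
Qed.

(** * The divisorial valuations attached to multiples of (1, 0) *)

Lemma ev_sum u v p : ev u v p =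
  \sum_(m <- msupp p) cst p@_m * (u ^+ m ord0 * v ^+ m ord_max).
Proof.
rewrite /ev /= /mmap; apply: eq_bigr => m _; rewrite /mmap1 !big_ord_recl big_ord0 mulr1.
by congr (_ * (_ * v ^+ m _)); apply: val_inj.
Qed.

Lemma mcoeff_YXn j r (m : 'X_{1..2}) : (m ord_max < j)%N -> (Y ^+ j * r)@_m = 0.
Proof.
move=> mj; apply: memN_msupp_eq0; apply/negP.
rewrite mulrC mpolyXn (perm_mem (msuppMX _ _)) => /mapP[m' _ mE].
by move: mj; rewrite mE mnmDE mulmnE mnm1E eqxx mul1n; lia.
Qed.

(** The monomials x^i y^(n i + j) are pairwise distinct, so that the terms with
   the fewest factors y do not cancel. *)
Lemma ord_y_shear_le q n m : m \in msupp q ->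
  ord_y (ev (x * y ^ n) y q) <= n * (m ord0)%:Z + (m ord_max)%:Z.
Proof.
move=> mq; have vy := ord_y_valuation.
(* N shifts all the exponents of y that occur to nonnegative ones. *)
pose N := (absz n * msize q)%N.
pose e (m' : 'X_{1..2}) := absz (n * (m' ord0)%:Z + (m' ord_max)%:Z + N%:Z).
have eE m' : m' \in msupp q -> (e m')%:Z = n * (m' ord0)%:Z + (m' ord_max)%:Z + N%:Z.
  move=> m'q; rewrite /e gez0_abs //.
  have : (m' ord0 <= msize q)%N.
    by apply: leq_trans (ltnW (msize_mdeg_lt m'q)); rewrite mdegE big_ord_recl leq_addr.
  by rewrite /N; nia.
pose M (m' : 'X_{1..2}) : 'X_{1..2} := (U_(ord0) *+ m' ord0 + U_(ord_max) *+ e m')%MM.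
pose P : {mpoly k[2]} := \sum_(m' <- msupp q) q@_m' *: 'X_[M m'].
have M0 m' : M m' ord0 = m' ord0 by rewrite mnmDE !mulmnE !mnm1E mul1n mul0n addn0.
have M1 m' : M m' ord_max = e m' by rewrite mnmDE !mulmnE !mnm1E mul1n mul0n.
have PE : y ^+ N * ev (x * y ^ n) y q = iota P.
  rewrite ev_sum mulr_sumr rmorph_sum /= !big_seq; apply: eq_bigr => m' m'q.
  rewrite -mul_mpolyC rmorphM mulrCA; congr (_ * _).
  rewrite /M mpolyXD -!mpolyXn rmorphM !rmorphXn /= exprMn.
  have -> : y ^+ e m' = (y ^ n) ^+ m' ord0 * y ^+ m' ord_max * y ^+ N.
    rewrite -[LHS]/(y ^ (e m')%:Z) eE // !expfzDr ?y_neq0 //.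
    by rewrite -exprz_exp.
  by rewrite -!mulrA mulrCA; congr (_ * _); rewrite mulrC -!mulrA.
have Pm : P@_(M m) = q@_m.
  rewrite /P raddf_sum /= (bigD1_seq m) ?msupp_uniq //= mcoeffZ mcoeffX eqxx mulr1.
  rewrite big_seq_cond big1 ?addr0 // => m' /andP[m'q m'm].
  rewrite mcoeffZ mcoeffX; case: eqP => [MM|]; last by rewrite mulr0.
  case/negP: m'm; apply/eqP/mnmP => i.
  have h0 : m' ord0 = m ord0 by rewrite -M0 MM M0.
  have h1 : m' ord_max = m ord_max.
    by have := eE _ m'q; rewrite -M1 MM M1 eE // h0; lia.
  by case: (ord2P i) => ->.
have P0 : P != 0.
  by apply/eqP => P0; move: mq; rewrite mcoeff_msupp -Pm P0 mcoeff0 eqxx.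
have ev0' : ev (x * y ^ n) y q != 0.
  by move: P0; rewrite -iota_eq0 -PE mulf_eq0 negb_or => /andP[].
rewrite leNgt; apply/negP => lt1.
have [|r PY] := @ord_y_dvd P (e m).+1.
  rewrite -PE /vge (valM vy) ?(valXn vy) ?expf_neq0 ?y_neq0 // ord_y_y; apply/orP; right.
  by rewrite intS eE //; lia.
by move: mq; rewrite mcoeff_msupp -Pm PY mcoeff_YXn ?M1 ?eqxx.
Qed.

Lemma y1_neq0 : 1 + y != 0.
Proof.
apply/eqP => e; have /(congr1 ev0) : 1 + Y = 0.
  by apply: iota_inj; rewrite rmorphD rmorph1 rmorph0.
by rewrite rmorphD rmorph1 evY rmorph0 addr0; apply/eqP/oner_neq0.
Qed.

(** In the chart x = x' y'^n, y = y' - 1 the axis y' = 0 is, for n > 0, the n-th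
   special divisor over the side x = 0, for n < 0 the |n|-th one over the opposite
   side, and for n = 0 the curve 1 + y = 0. *)
Variable chart : int -> {rmorphism K -> K}.
Hypothesis chart_cst : forall n c, chart n (cst c) = cst c.
Hypothesis chart_x : forall n, chart n x = x * y ^ n.
Hypothesis chart_y : forall n, chart n y = y - 1.

Definition axis_val (n : int) : K -> int := ord_y \o chart n.

Lemma axis_valuation n : valuation cst (axis_val n).
Proof. exact: (val_pullback ord_y_valuation (chart_cst n)). Qed.

Lemma axis_val_x n : axis_val n x = n.
Proof.
have vy := ord_y_valuation; rewrite /axis_val /= chart_x.
by rewrite (valM vy) ?expfz_neq0 ?x_neq0 ?y_neq0 // (valXz vy) ord_y_x ord_y_y mulr1 add0r.
Qed.

Lemma axis_val_y n : axis_val n y = 0.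
Proof.
rewrite /axis_val /= chart_y -(rmorph1 iota) -rmorphB; apply: ord_y_ev0.
by rewrite rmorphB evY rmorph1 sub0r oppr_eq0 oner_neq0.
Qed.

Lemma chart_y1 n : chart n (1 + y) = y.
Proof. by rewrite rmorphD rmorph1 chart_y addrC subrK. Qed.

Lemma axis_val_y1 n : axis_val n (1 + y) = 1.
Proof. by rewrite /axis_val /= chart_y1 ord_y_y. Qed.

(** The substitution of y - 1 for y, together with its inverse. *)
Lemma translate_poly p :
  exists q, ev x (y - 1) p = iota q /\ iota p = ev x (1 + y) q.
Proof.
elim/mpoly2_ind: p => [c|||p q [p' [e1 e2]] [q' [e3 e4]]|p q [p' [e1 e2]] [q' [e3 e4]]].
- by exists c%:MP; rewrite !evC.
- by exists X; rewrite !evX.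
- exists (Y - 1); rewrite evY !rmorphB !rmorph1 /= evY; split=> //.
  by rewrite addrAC subrr add0r.
- by exists (p' + q'); rewrite !rmorphD /= e1 e2 e3 e4.
- by exists (p' * q'); rewrite !rmorphM /= e1 e2 e3 e4.
Qed.

(** * Valuations of the special divisors *)

(** A curve of the torus, seen through its valuation [nu] and an equation [f]
   of it, that is a generator of the prime ideal where [nu] is positive. *)
Record curve nu f : Prop := Curve {
  curve_val : valuation cst nu;
  curve_laurent : laurent f;
  curve_one : nu f = 1;
  curve_ge0 : forall g, laurent g -> vge nu 0 g;
  curve_dvd : forall g, laurent g -> vge nu 1 g -> laurent (g / f) }.

Lemma curve_neq0 nu f : curve nu f -> f != 0.
Proof.
by move=> c; apply/eqP => f0; have := curve_one c; rewrite f0 (val0 (curve_val c)).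
Qed.

Lemma laurent_y1 : laurent (1 + y).
Proof. by apply: laurentD; [exact: laurent1 | exact: laurent_y]. Qed.

(** A Laurent polynomial of positive value becomes divisible by y after the
   translation y -> y - 1, hence is divisible by 1 + y. *)
Lemma curve_y1 : curve (axis_val 0) (1 + y).
Proof.
have v0 := axis_valuation 0.
have vxy n : axis_val 0 ((x * y) ^+ n) = 0.
  by rewrite (valXn v0) (valM v0) ?x_neq0 ?y_neq0 // axis_val_x axis_val_y addr0 mulr0.
have chartP p : chart 0 (iota p) = ev x (y - 1) p.
  by rewrite -ev_xy (rmorph_ev _ _ _ (chart_cst 0)) chart_x chart_y expr0z mulr1.
have red g d : laurent g -> vge (axis_val 0) d g -> exists n p,
    g = iota p / (x * y) ^+ n /\ vge (axis_val 0) d (iota p).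
  move=> /laurent_clear[n [p gE]] gd; exists n, p.
  split; first by rewrite -gE mulfK ?xy_neq0.
  by rewrite -gE -[d]addr0; apply: (vgeM v0) => //; rewrite /vge vxy lexx orbT.
split=> //; [exact: laurent_y1 | exact: axis_val_y1 | move=> g lg | move=> g lg g1].
  have [n [p gE]] := laurent_clear lg; rewrite -[g](mulfK (xy_neq0 n)) gE -[0 : int]addr0.
  apply: (vgeM v0); last by rewrite /vge (valV v0) vxy oppr0 lexx orbT.
  have [q [e _]] := translate_poly p.
  have := vge_ord_y_poly q; rewrite /vge /axis_val /= chartP e iota_eq0.
  by rewrite -(iota_eq0 q) -e -chartP fmorph_eq0.
have [n [p [-> p1]]] := red _ _ lg g1; have [q [e1 e2]] := translate_poly p.
have [|r qE] := @ord_y_dvd q 1.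
  move: p1; rewrite /vge /axis_val /= chartP e1.
  by rewrite -[iota p == 0](fmorph_eq0 (chart 0)) chartP e1.
rewrite e2 qE expr1 rmorphM evY mulrAC [_ * ev _ _ r]mulrC mulfK ?y1_neq0 //.
apply: laurentM; last exact: laurent_xyV.
by apply: laurent_ev; [exact: laurent_x | exact: laurent_y1].
Qed.

Definition coprime_pair (p q : int) := exists u v : int, p * u + q * v = 1.

(** Valuations that behave on monomials as the order along the toric divisor of
   the direction of (a, b), multiplied so as to give the vector (a, b), and
   whose centre lies on the closure of the curves 1 + z = 0, where z is a
   primitive monomial of value 0. *)
Record special (a b : int) nu : Prop := Special {
  special_val : valuation cst nu;
  special_x : nu x = a;
  special_y : nu y = b;
  special_ge : forall p q : int, coprime_pair p q -> p * a + q * b = 0 ->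
    vge nu 1 (1 + x ^ p * y ^ q) }.

Lemma special_ge_y1 a nu : special a 0 nu -> vge nu 1 (1 + y).
Proof.
move=> s; have -> : 1 + y = 1 + x ^ 0 * y ^ 1 by rewrite expr0z expr1z mul1r.
apply: (special_ge s); last by rewrite mul0r mulr0.
by exists 0, 1; rewrite mul0r add0r mulr1.
Qed.

(** The order along the special divisor of (a, b) is the smallest special
   valuation on Laurent polynomials.  This makes it visibly unique and
   compatible with the birational maps that permute the sets of special
   valuations. *)
Definition special_min a b nu := special a b nu /\
  forall nu', special a b nu' -> forall f, laurent f -> f != 0 -> nu f <= nu' f.

Lemma special_min_uniq a b nu nu' :
  special_min a b nu -> special_min a b nu' -> nu = nu'.
Proof.
move=> [s m] [s' m']; apply: val_eq_laurent => [||f lf f0].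
- exact: special_val s.
- exact: special_val s'.
by apply/eqP; rewrite eq_le m // m'.
Qed.

(** A polynomial is a combination of monomials in x and 1 + y.  Its value in the
   chart is the least value of the terms that occur, whereas any special
   valuation is at least this large on each term. *)
Lemma special_min_axis n : n != 0 -> special_min n 0 (axis_val n).
Proof.
move=> n0; have vn := axis_valuation n.
have sn : special n 0 (axis_val n).
  split=> //; [exact: axis_val_x | exact: axis_val_y |].
  (* Only the monomials y and 1 / y have to be considered. *)
  move=> p q [u [v uv]]; rewrite mulr0 addr0 => /eqP.
  rewrite mulf_eq0 (negPf n0) orbF => /eqP p0.
  have qv : q * v = 1 by rewrite -uv p0 mul0r add0r.
  have q1 : absz q = 1%N.
    by have /(congr1 absz)/eqP := qv; rewrite abszM muln_eq1 => /andP[/eqP->].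
  have : q = 1 \/ q = -1 by lia.
  rewrite p0 expr0z mul1r => -[]->.
    by rewrite expr1z /vge axis_val_y1 lexx orbT.
  have -> : 1 + y ^ (-1) = (1 + y) / y.
    by rewrite exprN1; field; rewrite y_neq0.
  rewrite /vge (valM vn) ?invr_eq0 ?y1_neq0 ?y_neq0 // axis_val_y1 (valV vn).
  by rewrite axis_val_y oppr0 addr0 lexx orbT.
split=> // nu s f lf f0; have vs := special_val s; have [N [p fE]] := laurent_clear lf.
have [q [e1 e2]] := translate_poly p.
have ip0 : iota p != 0 by rewrite -fE mulf_neq0 ?xy_neq0.
have vxy (nu' : K -> int) : special n 0 nu' -> nu' f = nu' (iota p) - N%:Z * n.
  move=> [v' x' y' _]; rewrite -fE (valM v') ?xy_neq0 // (valXn v').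
  by rewrite (valM v') ?x_neq0 ?y_neq0 // x' y' addr0 addrK.
rewrite (vxy _ sn) (vxy _ s) lerD2r; set d := axis_val n _.
apply: (val_ge ip0); rewrite e2 ev_sum; apply: (vge_sum vs) => m mq.
have dle : d <= n * (m ord0)%:Z + (m ord_max)%:Z.
  rewrite /d e2 /axis_val /= (rmorph_ev _ _ _ (chart_cst n)) chart_x chart_y1.
  exact: ord_y_shear_le.
apply: (vgeW dle); rewrite -[n * _ + _]add0r.
apply: (vgeM vs); first exact: vge_cst.
apply: (vgeM vs); first by rewrite /vge (valXn vs) (special_x s) mulrC lexx orbT.
rewrite -[(m ord_max)%:Z]mulr1; apply: (vgeXn vs).
exact: special_ge_y1 s.
Qed.

(** ** Monomial substitutions *)

Record toric (a b c d : int) (s : {rmorphism K -> K}) : Prop := Toric {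
  toric_cst : forall z, s (cst z) = cst z;
  toric_x : s x = x ^ a * y ^ b;
  toric_y : s y = x ^ c * y ^ d }.

Lemma toric_monomial a b c d s (p q : int) : toric a b c d s ->
  s (x ^ p * y ^ q) = x ^ (p * a + q * c) * y ^ (p * b + q * d).
Proof.
move=> t; rewrite rmorphM !fmorphXz (toric_x t) (toric_y t).
rewrite !exprzMl ?unitfE ?expfz_neq0 ?x_neq0 ?y_neq0 // !exprz_exp.
rewrite [a * p]mulrC [b * p]mulrC [c * q]mulrC [d * q]mulrC.
by rewrite !expfzDr ?x_neq0 ?y_neq0 // mulrACA.
Qed.

Lemma toric_laurent a b c d s f : toric a b c d s -> laurent f -> laurent (s f).
Proof.
move=> t; elim=> [z|n m|{}f g _ IHf _ IHg|{}f g _ IHf _ IHg].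
- by rewrite (toric_cst t); apply: laurent_cst.
- by rewrite (toric_monomial _ _ t); apply: laurent_monomial.
- by rewrite rmorphD; apply: laurentD.
- by rewrite rmorphM; apply: laurentM.
Qed.

Lemma special_toric a b c d s i j nu : a * d - b * c = 1 -> toric a b c d s ->
  special i j nu -> special (a * i + b * j) (c * i + d * j) (nu \o s).
Proof.
move=> det t h; have vh := special_val h.
split=> [|||p q [u [v uv]] pq] /=.
- exact: (val_pullback vh (toric_cst t)).
- by rewrite (toric_x t) (val_monomial vh) ?x_neq0 ?y_neq0 // (special_x h) (special_y h).
- by rewrite (toric_y t) (val_monomial vh) ?x_neq0 ?y_neq0 // (special_x h) (special_y h).
rewrite /vge -(fmorph_eq0 s) /= !rmorphD rmorph1 (toric_monomial _ _ t).
apply: (special_ge h); last by rewrite -pq; ring.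
exists (d * u - b * v), (a * v - c * u).
transitivity ((p * u + q * v) * (a * d - b * c)); first by ring.
by rewrite uv det.
Qed.

Lemma special_min_toric a b c d s s' i j nu : a * d - b * c = 1 ->
  toric a b c d s -> toric d (- b) (- c) a s' -> cancel s s' ->
  special_min i j nu -> special_min (a * i + b * j) (c * i + d * j) (nu \o s).
Proof.
move=> det t t' ss' [h hmin]; split=> [|nu' h' f lf f0]; first exact: special_toric.
rewrite -[X in nu' X]ss'; apply: (hmin (nu' \o s')); rewrite ?fmorph_eq0 //.
  have ei : d * (a * i + b * j) + - b * (c * i + d * j) = i.
    by rewrite -[RHS]mul1r -[in RHS]det; ring.
  have ej : - c * (a * i + b * j) + a * (c * i + d * j) = j.
    by rewrite -[RHS]mul1r -[in RHS]det; ring.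
  rewrite -[X in special X _ _]ei -[X in special _ X _]ej.
  by apply: special_toric t' h'; rewrite -det; ring.
exact: toric_laurent t lf.
Qed.

(** ** The substitution x -> x (1 + y)^e *)

Record mutation (e : int) (s : {rmorphism K -> K}) : Prop := Mutation {
  mut_cst : forall z, s (cst z) = cst z;
  mut_x : s x = x * (1 + y) ^ e;
  mut_y : s y = y }.

Lemma mut_y1 e s : mutation e s -> s (1 + y) = 1 + y.
Proof. by move=> t; rewrite rmorphD rmorph1 (mut_y t). Qed.

Lemma mut_monomial e s (p q : int) : mutation e s ->
  s (x ^ p * y ^ q) = x ^ p * y ^ q * (1 + y) ^ (e * p).
Proof.
move=> t; rewrite rmorphM !fmorphXz (mut_x t) (mut_y t).
rewrite exprzMl ?unitfE ?expfz_neq0 ?x_neq0 ?y1_neq0 // exprz_exp.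
by rewrite mulrAC.
Qed.

Lemma special_y1 a b nu : b != 0 -> special a b nu -> nu (1 + y) = Num.min 0 b.
Proof.
move=> b0 h; have vh := special_val h.
have [bn|bp|] := ltrgt0P b; last by move/eqP; rewrite (negPf b0).
  have [|_ ->] := valD_dominant vh (f := 1) (g := y) (oner_neq0 _).
    by rewrite (val1 vh) add0r /vge (special_y h) -gtz0_ge1 bn orbT.
  exact: val1 vh.
have [|_] := valD_dominant vh (f := y) (g := 1) y_neq0; last first.
  by rewrite addrC => ->; rewrite (special_y h).
by rewrite /vge (val1 vh) (special_y h) lezD1 bp orbT.
Qed.

Lemma vge_expz_sub1 nu w n : valuation cst nu -> w != 0 -> vge nu 1 (w - 1) ->
  vge nu 1 (w ^ n - 1).
Proof.
move=> vh w0 w1; have nw : nu w = 0.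
  have [|_] := valD_dominant vh (f := 1) (g := w - 1) (oner_neq0 _).
    by rewrite (val1 vh) add0r.
  by rewrite addrC subrK (val1 vh).
have wn i : vge nu 1 (w ^+ i - 1).
  elim: i => [|i IHi]; first by rewrite expr0 subrr /vge eqxx.
  have -> : w ^+ i.+1 - 1 = w * (w ^+ i - 1) + (w - 1) by rewrite exprS; ring.
  apply: (vgeD vh) => //; rewrite -[1 : int]add0r; apply: (vgeM vh) => //.
  by rewrite /vge nw lexx orbT.
case: n => i; first exact: wn.
have wi : w ^+ i.+1 != 0 by rewrite expf_neq0.
rewrite NegzE -exprnN.
have -> : w ^- i.+1 - 1 = w ^- i.+1 * - (w ^+ i.+1 - 1) by field.
rewrite -[1 : int]add0r; apply: (vgeM vh); last by rewrite (vgeN vh).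
by rewrite /vge (valV vh) (valXn vh) nw mulr0 oppr0 lexx orbT.
Qed.

Lemma special_ge_twist a b nu w (p q r : int) : special a b nu -> w != 0 ->
  vge nu 1 (w - 1) -> coprime_pair p q -> p * a + q * b = 0 ->
  vge nu 1 (1 + x ^ p * y ^ q * w ^ r).
Proof.
move=> h w0 w1 cpq pq; have vh := special_val h.
have -> : 1 + x ^ p * y ^ q * w ^ r =
    (1 + x ^ p * y ^ q) + x ^ p * y ^ q * (w ^ r - 1) by ring.
apply: (vgeD vh); first exact: (special_ge h).
rewrite -[1 : int]add0r; apply: (vgeM vh); last exact: vge_expz_sub1.
rewrite /vge (val_monomial vh) ?x_neq0 ?y_neq0 // (special_x h) (special_y h).
by rewrite pq lexx orbT.
Qed.

(** For b > 0 the factor 1 + y is congruent to 1 along the divisor; for b < 0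
   it is y times such a factor, whence the shear of the lower half plane. *)
Lemma special_mutation e s a b nu : b != 0 -> mutation e s -> special a b nu ->
  special (a + e * Num.min 0 b) b (nu \o s).
Proof.
move=> b0 t h; have vh := special_val h.
split=> [|||p q [u [v uv]] pq] /=.
- exact: (val_pullback vh (mut_cst t)).
- rewrite (mut_x t) (valM vh) ?expfz_neq0 ?x_neq0 ?y1_neq0 // (valXz vh).
  by rewrite (special_y1 b0 h) (special_x h).
- by rewrite (mut_y t) (special_y h).
rewrite /vge -(fmorph_eq0 s) /= !rmorphD rmorph1 (mut_monomial _ _ t).
have [bp|bn|] := ltrgt0P b; last by move/eqP; rewrite (negPf b0).
  apply: (special_ge_twist _ h) => //; first exact: y1_neq0.
  - by rewrite addrC addKr /vge (special_y h) -gtz0_ge1 bp orbT.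
  - by exists u, v.
  - by move: pq; rewrite min_l ?ltW // mulr0 addr0.
pose w := 1 + y^-1; have yw : 1 + y = y * w.
  by rewrite /w mulrDr mulr1 mulfV ?y_neq0 // addrC.
have w0 : w != 0 by have := y1_neq0; rewrite yw mulf_eq0 negb_or => /andP[].
have -> : x ^ p * y ^ q * (1 + y) ^ (e * p) = x ^ p * y ^ (q + e * p) * w ^ (e * p).
  by rewrite yw exprzMl ?unitfE ?y_neq0 // expfzDr ?y_neq0 // !mulrA.
apply: (special_ge_twist _ h) => //.
- by rewrite /w addrC addKr /vge (valV vh) (special_y h) -gtz0_ge1 oppr_gt0 bn orbT.
- by exists (u - e * v), v; rewrite -[RHS]uv; ring.
by rewrite -pq min_r ?ltW //; ring.
Qed.

Lemma mutation_laurent e s f : mutation e s -> laurent f ->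
  exists n, laurent (s f * (1 + y) ^+ n).
Proof.
move=> t; have ly n := laurentX n laurent_y1.
elim=> [z|n m|{}f g _ [n lf] _ [m lg]|{}f g _ [n lf] _ [m lg]].
- by exists 0%N; rewrite (mut_cst t) mulr1; apply: laurent_cst.
- exists (absz (e * n)); rewrite (mut_monomial _ _ t).
  have -> : x ^ n * y ^ m * (1 + y) ^ (e * n) * (1 + y) ^+ absz (e * n) =
      x ^ n * y ^ m * (1 + y) ^ (e * n + (absz (e * n))%:Z).
    by rewrite expfzDr ?y1_neq0 // mulrA.
  apply: laurentM; first exact: laurent_monomial.
  have : 0 <= e * n + (absz (e * n))%:Z by lia.
  by case: (e * n + _) => // i _; apply: ly.
- exists (n + m)%N; rewrite rmorphD mulrDl; apply: laurentD.
    by rewrite exprD mulrA; apply: laurentM.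
  by rewrite addnC exprD mulrA; apply: laurentM.
exists (n + m)%N; rewrite rmorphM exprD mulrACA; exact: laurentM.
Qed.

(** The substitution does not preserve Laurent polynomials, but the denominators
   that it creates are powers of 1 + y, where all special valuations of (a, b)
   agree. *)
Lemma special_min_mutation e s s' a b nu : b != 0 -> mutation e s ->
  mutation (- e) s' -> cancel s s' ->
  special_min a b nu -> special_min (a + e * Num.min 0 b) b (nu \o s).
Proof.
move=> b0 t t' ss' [h hmin]; split=> [|nu' h' f lf f0]; first exact: special_mutation.
have h'' : special a b (nu' \o s').
  have -> : a = a + e * Num.min 0 b + - e * Num.min 0 b by ring.
  exact: special_mutation.
have [n ln] := mutation_laurent t lf.
have y1 := expf_neq0 n y1_neq0.
have := hmin _ h'' _ ln; rewrite mulf_neq0 ?fmorph_eq0 // => /(_ isT) /=.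
have vh := special_val h; have vh' := special_val h'.
rewrite rmorphM ss' rmorphXn /= (mut_y1 t') (valM vh) ?fmorph_eq0 // (valM vh') //.
by rewrite (valXn vh) (valXn vh') (special_y1 b0 h) (special_y1 b0 h') lerD2r.
Qed.

(** ** Curves of the torus under substitutions *)

(** Two equations of a curve divide each other, so differ by a unit. *)
Lemma curve_unit nu f f' : curve nu f -> curve nu f' ->
  exists c (n m : int), [/\ c != 0 & f' = cst c * (x ^ n * y ^ m) * f].
Proof.
move=> h h'; have [f0 f'0] := (curve_neq0 h, curve_neq0 h').
have l1 : laurent (f' / f).
  by apply: (curve_dvd h (curve_laurent h')); rewrite /vge (curve_one h') lexx orbT.
have l2 : laurent (f / f').
  by apply: (curve_dvd h' (curve_laurent h)); rewrite /vge (curve_one h) lexx orbT.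
have [||c [n [m [c0 e]]]] := laurent_unit l1; first by rewrite invf_div.
  by rewrite mulf_neq0 ?invr_eq0.
by exists c, n, m; rewrite -e divfK.
Qed.

Lemma curve_toric a b c d a' b' c' d' s s' nu f : toric a b c d s ->
  toric a' b' c' d' s' -> cancel s s' -> cancel s' s ->
  curve nu f -> curve (nu \o s) (s' f).
Proof.
move=> t t' ss' s's h; split=> /=.
- exact: (val_pullback (curve_val h) (toric_cst t)).
- exact: (toric_laurent t' (curve_laurent h)).
- by rewrite s's (curve_one h).
- move=> g lg; have := curve_ge0 h (toric_laurent t lg).
  by rewrite /vge fmorph_eq0.
move=> g lg g1; rewrite -[g]ss' -fmorph_div; apply: (toric_laurent t').
by apply: (curve_dvd h); [exact: toric_laurent t lg | move: g1; rewrite /vge fmorph_eq0].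
Qed.

(** Positive order along 1 + y = 0 means divisibility by 1 + y, which removes a
   denominator one factor at a time. *)
Lemma laurent_delocalize f (n : int) : laurent (f * (1 + y) ^ n) ->
  vge (axis_val 0) 0 f -> laurent f.
Proof.
move=> + f0; have v0 := axis_valuation 0; case: n => n; last first.
  move=> ln; rewrite -[f](divfK (expf_neq0 n.+1 y1_neq0)) exprnN.
  by apply: laurentM => //; apply: laurentX; apply: laurent_y1.
rewrite -[_ ^ _]/(_ ^+ n); elim: n => [|n IHn] ln; first by rewrite -[f]mulr1.
apply: IHn; rewrite -[X in laurent X](mulfK y1_neq0) -(mulrA f) -exprSr.
apply: (curve_dvd curve_y1) => //; rewrite -[1 : int]add0r; apply: (vgeM v0) => //.
by rewrite /vge (valXn v0) axis_val_y1 intS mulr1 lerDl orbT.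
Qed.

(** If 1 + y vanishes on the curve f = 0, then f divides 1 + y.  As 1 + y is
   prime, it also divides f, and dividing a Laurent polynomial by f or by 1 + y
   lowers both valuations by one. *)
Lemma curve_y1_pos nu f : curve nu f -> nu (1 + y) != 0 -> nu = axis_val 0.
Proof.
move=> h n0; have vh := curve_val h; have v0 := axis_valuation 0; have f0 := curve_neq0 h.
have h0 := curve_y1; have y10 := y1_neq0.
have npos : vge nu 1 (1 + y).
  have := curve_ge0 h laurent_y1; rewrite /vge (negPf y1_neq0) /=; lia.
pose r := (1 + y) / f; have lr : laurent r := curve_dvd h laurent_y1 npos.
have r0 : r != 0 by rewrite mulf_neq0 ?invr_eq0.
have frE : 1 + y = f * r by rewrite /r mulrC divfK.
have f1 : vge (axis_val 0) 1 f.
  have : axis_val 0 f + axis_val 0 r = 1 by rewrite -(valM v0) // -frE axis_val_y1.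
  have := curve_ge0 h0 (curve_laurent h); rewrite /vge (negPf f0) /=.
  have := curve_ge0 h0 lr; rewrite /vge (negPf r0) /= => r_ge0 f_ge0 sum1.
  have [//|f_eq0] : 1 <= axis_val 0 f \/ axis_val 0 f = 0 by lia.
  have r1 : vge (axis_val 0) 1 r by rewrite /vge; lia.
  have lr1 := curve_dvd h0 lr r1; have := curve_ge0 h lr1.
  have -> : r / (1 + y) = f^-1 by rewrite frE invfM mulrCA mulfV // mulr1.
  by rewrite /vge invr_eq0 (negPf f0) (valV vh) (curve_one h).
have lf := curve_dvd h0 (curve_laurent h) f1.
have rV : r^-1 = f / (1 + y) by rewrite /r invf_div.
have key d g : laurent g -> g != 0 -> (absz (nu g) <= d)%N -> nu g = axis_val 0 g.
  elim: d g => [|d IHd] g lg g0 gd;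
    have := curve_ge0 h lg; rewrite /vge (negPf g0) /= => gp.
    have g00 : nu g = 0 by lia.
    have := curve_ge0 h0 lg; rewrite /vge (negPf g0) /= g00 => gp'.
    have [//|g1] : 0 = axis_val 0 g \/ 1 <= axis_val 0 g by lia.
    have lg1 : laurent (g / (1 + y)).
      by apply: (curve_dvd h0) => //; rewrite /vge g1 orbT.
    have := curve_ge0 h lg1; rewrite /vge mulf_eq0 invr_eq0 (negPf g0) (negPf y10) /=.
    rewrite (valM vh) ?invr_eq0 // (valV vh) g00.
    by move: npos; rewrite /vge (negPf y10) /=; lia.
  have [g00|g1] : nu g = 0 \/ 1 <= nu g by lia.
    by apply: IHd; rewrite ?g00.
  have lgf : laurent (g / f) by apply: (curve_dvd h) => //; rewrite /vge g1 orbT.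
  have gf0 : g / f != 0 by rewrite mulf_neq0 ?invr_eq0.
  have nuE : nu (g / f) = nu g - 1.
    by rewrite (valM vh) ?invr_eq0 // (valV vh) (curve_one h).
  have rr : axis_val 0 r = 0.
    have := curve_ge0 h0 lr; have := curve_ge0 h0 lf.
    rewrite -rV /vge invr_eq0 (negPf r0) /= (valV v0).
    by lia.
  have fE : axis_val 0 f = 1.
    have : axis_val 0 f + axis_val 0 r = 1 by rewrite -(valM v0) // -frE axis_val_y1.
    by rewrite rr addr0.
  have := IHd _ lgf gf0; rewrite nuE (valM v0) ?invr_eq0 // (valV v0) fE.
  by move=> /(_ _)/addIr; apply; lia.
apply: val_eq_laurent => // g lg g0; exact: (key _ g lg g0 (leqnn _)).
Qed.

Lemma curve_coprime_y1 nu f : curve nu f -> nu (1 + y) = 0 -> axis_val 0 f = 0.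
Proof.
move=> h n0; have vh := curve_val h; have v0 := axis_valuation 0; have f0 := curve_neq0 h.
have h0 := curve_y1; have y10 := y1_neq0.
have := curve_ge0 h0 (curve_laurent h); rewrite /vge (negPf f0) /= => fp.
have [//|f1] : axis_val 0 f = 0 \/ 1 <= axis_val 0 f by lia.
have f1' : vge (axis_val 0) 1 f by rewrite /vge f1 orbT.
have lf := curve_dvd h0 (curve_laurent h) f1'.
have lr : laurent (f / (1 + y) / f).
  apply: (curve_dvd h) => //; rewrite /vge (valM vh) ?invr_eq0 // (valV vh) n0.
  by rewrite (curve_one h) orbT.
have := curve_ge0 h0 lr.
have -> : f / (1 + y) / f = (1 + y)^-1 by rewrite mulrAC mulfV // mul1r.
by rewrite /vge invr_eq0 (negPf y10) (valV v0) axis_val_y1.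
Qed.

(** A curve other than 1 + y = 0 has an image under the mutation; its equation
   is normalised so as not to vanish along 1 + y = 0. *)
Lemma curve_mutation e s s' nu f : mutation e s -> mutation (- e) s' ->
  cancel s s' -> cancel s' s -> curve nu f -> nu (1 + y) = 0 ->
  curve (nu \o s) (s' f * (1 + y) ^ (- axis_val 0 (s' f))).
Proof.
move=> t t' ss' s's h n0; have vh := curve_val h; have v0 := axis_valuation 0.
have f0 := curve_neq0 h; have y10 := y1_neq0; set d := - _; set f' := _ * _.
have s'f0 : s' f != 0 by rewrite fmorph_eq0.
have f'0 : f' != 0 by rewrite mulf_neq0 ?expfz_neq0.
have v0f' : axis_val 0 f' = 0.
  by rewrite (valM v0) ?expfz_neq0 // (valXz v0) axis_val_y1 mulr1 /d subrr.
have sf' : s f' = f * (1 + y) ^ d by rewrite rmorphM s's fmorphXz (mut_y1 t).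
have loc (u : {rmorphism K -> K}) e' g (m : int) : mutation e' u -> laurent g ->
    vge (axis_val 0) 0 (u g * (1 + y) ^ m) -> laurent (u g * (1 + y) ^ m).
  move=> tu lg; have [n ln] := mutation_laurent tu lg.
  apply: (@laurent_delocalize _ (n%:Z - m)).
  by rewrite -mulrA -expfzDr // [m + _]addrC subrK.
have yn n : nu ((1 + y) ^ n) = 0 by rewrite (valXz vh) n0 mulr0.
split=> /=.
- exact: (val_pullback vh (mut_cst t)).
- by apply: (loc _ _ _ _ t' (curve_laurent h)); rewrite -/f' /vge v0f' lexx orbT.
- by rewrite sf' (valM vh) ?expfz_neq0 // yn addr0 (curve_one h).
- move=> g lg; have [n ln] := mutation_laurent t lg.
  have := curve_ge0 h ln; rewrite /vge mulf_eq0 fmorph_eq0 (negPf (expf_neq0 n y10)) orbF.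
  have [//|g0] /= := eqVneq g 0.
  by rewrite (valM vh) ?fmorph_eq0 ?expf_neq0 // (yn n) addr0.
move=> g lg g1; have [n ln] := mutation_laurent t lg.
have lq : laurent (s g * (1 + y) ^+ n / f).
  apply: (curve_dvd h) => //; rewrite -[1 : int]addr0; apply: (vgeM vh).
    by move: g1; rewrite /vge fmorph_eq0.
  by rewrite /vge (yn n) lexx orbT.
have gE : g / f' = s' (s g * (1 + y) ^+ n / f) * (1 + y) ^ (- n%:Z - d).
  rewrite !rmorphM fmorphV rmorphXn /= ss' (mut_y1 t') /f' expfzDr // -exprnN -invr_expz.
  exact/div_mul_cancel/expf_neq0.
rewrite gE; apply: (loc _ _ _ _ t' lq); rewrite -gE.
rewrite -[0 : int]addr0; apply: (vgeM v0); first exact: (curve_ge0 curve_y1).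
by rewrite /vge (valV v0) v0f' oppr0 lexx orbT.
Qed.

(** Homomorphisms fixing the constants are determined by the images of x and
   y. *)
Lemma rmorph_eq (s s' : {rmorphism K -> K}) :
  (forall c, s (cst c) = cst c) -> (forall c, s' (cst c) = cst c) ->
  s x = s' x -> s y = s' y -> s =1 s'.
Proof.
move=> sc sc' ex ey f; have [p [q [_ ->]]] := iota_frac f.
have e r : s (iota r) = s' (iota r).
  by rewrite -(ev_xy r) (rmorph_ev _ _ _ sc) (rmorph_ev _ _ _ sc') ex ey.
by rewrite !fmorph_div !e.
Qed.

Lemma toric_inv (a b c d : int) (s s' : {rmorphism K -> K}) :
  a * d - b * c = 1 -> toric a b c d s ->
  cancel s s' -> cancel s' s -> toric d (- b) (- c) a s'.
Proof.
move=> det t ss' s's; split=> [z||]; first by rewrite -{1}(toric_cst t z) ss'.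
  rewrite -[RHS]ss' (toric_monomial _ _ t); congr (s' _).
  have -> : d * a + - b * c = 1 by rewrite -det; ring.
  have -> : d * b + - b * d = 0 by ring.
  by rewrite expr0z expr1z mulr1.
rewrite -[RHS]ss' (toric_monomial _ _ t); congr (s' _).
have -> : - c * b + a * d = 1 by rewrite -det; ring.
have -> : - c * a + a * c = 0 by ring.
by rewrite expr0z expr1z mul1r.
Qed.

Lemma mutation_inv e (s s' : {rmorphism K -> K}) :
  mutation e s -> cancel s s' -> cancel s' s ->
  mutation (- e) s'.
Proof.
move=> t ss' s's; have sy : s' y = y by rewrite -{1}(mut_y t) ss'.
split=> // [z|]; first by rewrite -{1}(mut_cst t z) ss'.
rewrite -[RHS]ss' rmorphM fmorphXz (mut_y1 t) (mut_x t) -mulrA -expfzDr ?y1_neq0 //.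
by rewrite addrN expr0z mulr1.
Qed.

(** * The pairing of valuations with the lattice W *)

(** [act g] is the pullback of functions by g, which reverses products; the
   valuation nu is sent by g to [nu \o act g]. *)
Variables (G : groupType) (act : G -> {rmorphism K -> K}).
Hypothesis actM : forall (g h : G) f, act (g * h)%g f = act h (act g f).
Hypothesis act1 : forall f, act 1%g f = f.
Variable gam : SL2Z -> G.
Hypothesis act_gam : forall g : SL2Z,
  toric (val g ord0 ord0) (val g ord0 ord_max)
        (val g ord_max ord0) (val g ord_max ord_max) (act (gam g)).
Variable ip : G.
Hypothesis act_ip : mutation (- 1) (act ip).

Lemma actK (g : G) : cancel (act g) (act g^-1%g).
Proof. by move=> f; rewrite -actM mulgV act1. Qed.

Lemma actVK (g : G) : cancel (act g^-1%g) (act g).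
Proof. by move=> f; rewrite -actM mulVg act1. Qed.

Lemma det_SL2Z (g : SL2Z) :
  val g ord0 ord0 * val g ord_max ord_max - val g ord0 ord_max * val g ord_max ord0 = 1.
Proof. by rewrite -det2; apply/eqP/(valP g). Qed.

Lemma special_min_gam (g : SL2Z) i j nu : special_min i j nu ->
  special_min (val g ord0 ord0 * i + val g ord0 ord_max * j)
    (val g ord_max ord0 * i + val g ord_max ord_max * j) (nu \o act (gam g)).
Proof.
have t := act_gam g; have [k1 k2] := (@actK (gam g), @actVK (gam g)).
exact: special_min_toric (det_SL2Z g) t (toric_inv (det_SL2Z g) t k1 k2) k1.
Qed.

Lemma det_mx22 a b c d : \det (mx22 a b c d) = a * d - b * c.
Proof. by rewrite det2 !mxE. Qed.

(** By the Bezout identity every nonzero vector is the image under SL(2,Z) of a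
   multiple of (1, 0). *)
Lemma special_min_ex a b : (a != 0) || (b != 0) -> exists nu, special_min a b nu.
Proof.
move=> ab0; have [u [v uv]] := Bezoutz a b; pose n := gcdz a b.
have n0 : n != 0 by rewrite gcdz_eq0 negb_and.
have aE : (a %/ n)%Z * n = a by rewrite divzK // dvdz_gcdl.
have bE : (b %/ n)%Z * n = b by rewrite divzK // dvdz_gcdr.
have det : \det (mx22 (a %/ n)%Z (- v) (b %/ n)%Z u) == 1.
  rewrite det_mx22; apply/eqP/(mulIf n0); rewrite mul1r -[RHS]uv -{2}aE -{2}bE.
  by ring.
have := special_min_gam (MkSL2Z det) (special_min_axis n0).
rewrite /= !mxE /= !mulr0 !addr0 aE bE => h.
by exists (axis_val n \o act (gam (MkSL2Z det))).
Qed.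

Lemma Lambda_neq0 (l : Lambda) : (val l ord0 ord0 != 0) || (val l ord_max ord0 != 0).
Proof.
apply: contraR (valP l); rewrite negb_or !negbK => /andP[/eqP h0 /eqP h1].
by apply/eqP/matrixP => i j; rewrite ord1 mxE; case: (ord2P i) => ->.
Qed.

Definition lat_val (l : Lambda) : K -> int := sval (cid (special_min_ex (Lambda_neq0 l))).

Lemma lat_valP (l : Lambda) :
  special_min (val l ord0 ord0) (val l ord_max ord0) (lat_val l).
Proof. exact: svalP (cid (special_min_ex (Lambda_neq0 l))). Qed.

Lemma lat_special (l : Lambda) : special (val l ord0 ord0) (val l ord_max ord0) (lat_val l).
Proof. by have [] := lat_valP l. Qed.

Lemma lat_valuation (l : Lambda) : valuation cst (lat_val l).
Proof. exact: special_val (lat_special l). Qed.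

Lemma lat_val_inj l l' : lat_val l = lat_val l' -> l = l'.
Proof.
move=> e; apply: val_inj; apply/matrixP => i j; rewrite ord1.
have [h h'] := (lat_special l, lat_special l'); rewrite e in h.
case: (ord2P i) => ->; first by rewrite -(special_x h) (special_x h').
by rewrite -(special_y h) (special_y h').
Qed.

(** A curve of the torus has value 0 on monomials. *)
Lemma lat_val_not_curve l f : ~ curve (lat_val l) f.
Proof.
move=> h; have hl := lat_special l; have vl := curve_val h.
have z n m : lat_val l (x ^ n * y ^ m) = 0.
  have e : lat_val l (x ^ (- n) * y ^ (- m)) = - lat_val l (x ^ n * y ^ m).
    by rewrite !(val_monomial vl) ?x_neq0 ?y_neq0 //; ring.
  have := curve_ge0 h (laurent_monomial n m).
  have := curve_ge0 h (laurent_monomial (- n) (- m)).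
  rewrite /vge !mulf_eq0 !(negPf (expfz_neq0 _ x_neq0)) !(negPf (expfz_neq0 _ y_neq0)) /= e.
  by lia.
have := Lambda_neq0 l; rewrite -{1}(special_x hl) -(special_y hl).
by have := z 1 0; have := z 0 1; rewrite !expr1z !expr0z mul1r mulr1 => -> ->.
Qed.

(** ** The functionals of elements of W *)

(** As a function of f, this is the combination of the valuations of the special
   divisors with the coefficients of w. *)
Definition lam (f : K) : W -> int := W_ext (fun l => lat_val l f : int^o).

Lemma lamU f l : lam f << l >> = lat_val l f.
Proof. exact: (W_extU (fun l => lat_val l f : int^o) l). Qed.

Lemma lamB f w w' : lam f (w - w') = lam f w - lam f w'.
Proof. exact: (raddfB (W_ext (fun l => lat_val l f : int^o))). Qed.

Lemma lam0 f : lam f 0 = 0.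
Proof. exact: (raddf0 (W_ext (fun l => lat_val l f : int^o))). Qed.

Lemma lamMz f w n : lam f (w *~ n) = lam f w * n.
Proof. by rewrite /lam (raddfMz (W_ext (fun l => lat_val l f : int^o))) mulrzz. Qed.

Lemma lamM f g w : f != 0 -> g != 0 -> lam (f * g) w = lam f w + lam g w.
Proof.
move=> f0 g0; elim/W_ind: w => [|l|w w' IHw IHw']; first by rewrite !lam0.
  by rewrite !lamU (valM (lat_valuation l)).
by rewrite !lamB IHw IHw' opprD addrACA.
Qed.

Lemma lamXz f n w : lam (f ^ n) w = n * lam f w.
Proof.
elim/W_ind: w => [|l|w w' IHw IHw']; first by rewrite !lam0 mulr0.
  by rewrite !lamU (valXz (lat_valuation l)).
by rewrite !lamB IHw IHw' mulrBr.
Qed.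

Lemma lam_cst c w : lam (cst c) w = 0.
Proof.
elim/W_ind: w => [|l|w w' IHw IHw']; first by rewrite !lam0.
  by rewrite lamU (val_cst (lat_valuation l)).
by rewrite !lamB IHw IHw' subrr.
Qed.

Lemma lam_x w : lam x w = momentum w ord0 ord0.
Proof.
elim/W_ind: w => [|l|w w' IHw IHw']; first by rewrite !lam0 raddf0 mxE.
  by rewrite lamU momentumU (special_x (lat_special l)).
by rewrite !lamB IHw IHw' raddfB !mxE.
Qed.

Lemma lam_y w : lam y w = momentum w ord_max ord0.
Proof.
elim/W_ind: w => [|l|w w' IHw IHw']; first by rewrite !lam0 raddf0 mxE.
  by rewrite lamU momentumU (special_y (lat_special l)).
by rewrite !lamB IHw IHw' raddfB !mxE.
Qed.

Lemma lam_unit c (n m : int) w : momentum w = 0 -> c != 0 ->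
  lam (cst c * (x ^ n * y ^ m)) w = 0.
Proof.
move=> w0 c0; have [x0 y0'] := (x_neq0, y_neq0).
rewrite !lamM ?mulf_neq0 ?expfz_neq0 ?fmorph_eq0 // !lamXz lam_cst lam_x lam_y w0 !mxE.
by rewrite !mulr0.
Qed.

(** ** Coordinates along all divisors *)

(** The divisors of the surface on which the group acts are the special ones
   and the curves of the torus.  The coordinates of w along the latter are
   such that the combination of all the valuations vanishes on K^*. *)
Definition has_coord (w : W) (nu : K -> int) (n : int) : Prop :=
  (exists2 l, nu = lat_val l & n = coeff l w) \/
  (exists2 f, curve nu f & n = - lam f w).

Lemma has_coord_lat w l : has_coord w (lat_val l) (coeff l w).
Proof. by left; exists l. Qed.

(** The equation of a curve is unique up to a unit, on which the functional of
   an element of V vanishes. *)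
Lemma has_coord_uniq w nu n n' : momentum w = 0 ->
  has_coord w nu n -> has_coord w nu n' -> n = n'.
Proof.
move=> w0 [[l -> ->]|[f c ->]] [[l' e ->]|[f' c' ->]].
- by rewrite (lat_val_inj e).
- by case: (lat_val_not_curve c').
- by rewrite e in c; case: (lat_val_not_curve c).
have [z [i [j [z0 ->]]]] := curve_unit c c'; congr (- _).
have f0 := curve_neq0 c; have u0 : cst z * (x ^ i * y ^ j) != 0.
  apply: mulf_neq0; first by rewrite fmorph_eq0.
  by apply: mulf_neq0; apply: expfz_neq0; [exact: x_neq0 | exact: y_neq0].
by rewrite lamM // lam_unit // add0r.
Qed.

(** [F] transports coordinates along the birational map of pullback [s]. *)
Definition transports (s : K -> K) (F : W -> W) := forall w, momentum w = 0 ->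
  momentum (F w) = 0 /\
  forall nu n, has_coord w nu n -> has_coord (F w) (nu \o s) n.

Lemma transports_comp s s' F F' : transports s F -> transports s' F' ->
  transports (s \o s') (F' \o F).
Proof.
move=> h h' w w0; have [Fw0 hw] := h w w0; have [FFw0 hw'] := h' _ Fw0.
by split=> // nu n /hw/hw'.
Qed.

(** An operator that transports coordinates along the identity is the
   identity, since elements of W are determined by their coordinates along the
   special divisors. *)
Lemma transports_id s F w : s =1 id -> transports s F -> momentum w = 0 -> F w = w.
Proof.
move=> /funext -> h w0; have [Fw0 hw] := h w w0; apply/eqP/freeg_eqP => l.
exact: has_coord_uniq (has_coord_lat _ l) (hw _ _ (has_coord_lat w l)).
Qed.

Lemma gam_lat_proof (g : SL2Z) (l : Lambda) : val g *m val l != 0.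
Proof.
apply: contraNneq (valP l) => e.
by rewrite -[val l](mulKmx (SL2Z_unit g)) e mulmx0.
Qed.

Definition gam_lat (g : SL2Z) l : Lambda := Sub (val g *m val l) (gam_lat_proof g l).

Lemma gam_W_basis (g : SL2Z) l : gam_W g << l >> = << gam_lat g l >>.
Proof. by rewrite gam_WU -w_val. Qed.

Lemma gam_lat_inj (g : SL2Z) : injective (gam_lat g).
Proof.
move=> l l' /(congr1 val) /= e; apply: val_inj.
by rewrite -[val l](mulKmx (SL2Z_unit g)) e mulKmx ?SL2Z_unit.
Qed.

Lemma coeff_gam (g : SL2Z) l w : coeff (gam_lat g l) (gam_W g w) = coeff l w.
Proof.
elim/W_ind: w => [|l'|w w' IHw IHw']; first by rewrite !raddf0.
  by rewrite gam_W_basis !coeff_basis (inj_eq (@gam_lat_inj g)).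
by rewrite !raddfB /= IHw IHw'.
Qed.

Lemma lat_val_gam (g : SL2Z) l : lat_val (gam_lat g l) = lat_val l \o act (gam g).
Proof.
apply: (special_min_uniq (lat_valP _)).
have -> : val (gam_lat g l) ord0 ord0 = val g ord0 ord0 * val l ord0 ord0
    + val g ord0 ord_max * val l ord_max ord0.
  rewrite /= mxE big_ord_recl big_ord1.
  by congr (_ + val g _ _ * val l _ _); apply: val_inj.
have -> : val (gam_lat g l) ord_max ord0 = val g ord_max ord0 * val l ord0 ord0
    + val g ord_max ord_max * val l ord_max ord0.
  rewrite /= mxE big_ord_recl big_ord1.
  by congr (_ + val g _ _ * val l _ _); apply: val_inj.
exact: special_min_gam (lat_valP l).
Qed.

Lemma lam_gam (g : SL2Z) f w : lam f (gam_W g w) = lam (act (gam g) f) w.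
Proof.
elim/W_ind: w => [|l|w w' IHw IHw']; first by rewrite raddf0 !lam0.
  by rewrite gam_W_basis !lamU lat_val_gam.
by rewrite raddfB !lamB IHw IHw'.
Qed.

Lemma transports_gam (g : SL2Z) : transports (act (gam g)) (gam_W g).
Proof.
move=> w w0; split; first by rewrite momentum_gam w0 mulmx0.
move=> nu n [[l -> ->]|[f c ->]].
  by rewrite -lat_val_gam -(coeff_gam g); apply: has_coord_lat.
right; have [k1 k2] := (@actK (gam g), @actVK (gam g)); have t := act_gam g.
exists (act (gam g)^-1%g f); last by rewrite lam_gam k2.
exact: curve_toric t (toric_inv (det_SL2Z g) t k1 k2) k1 k2 c.
Qed.

(** ** The mutation on coordinates *)

Lemma pt_right_neq0 : pt 1 0 != 0.
Proof. by apply/eqP => /matrixP/(_ ord0 ord0)/eqP; rewrite !mxE oner_eq0. Qed.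

Lemma pt_left_neq0 : pt_left != 0.
Proof. by apply/eqP => /matrixP/(_ ord0 ord0)/eqP; rewrite !mxE oppr_eq0 oner_eq0. Qed.

Definition lat_right : Lambda := Sub (pt 1 0) pt_right_neq0.
Definition lat_left : Lambda := Sub pt_left pt_left_neq0.

Lemma beta_pt_left : beta pt_left = 1.
Proof. by rewrite /beta pt1 eqxx. Qed.

Lemma mut_pt_inj : injective mut_pt.
Proof.
move=> i j e; have e1 : i ord_max ord0 = j ord_max ord0.
  by move/matrixP/(_ ord_max ord0): e; rewrite !pt1.
apply: cV2_eq => //; move/matrixP/(_ ord0 ord0): e; rewrite !pt0 /beta e1.
exact: addIr.
Qed.

Lemma mut_pt_eq0 i : (mut_pt i == 0) = (i == pt 1 0).
Proof.
have <- : mut_pt (pt 1 0) = 0.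
  by apply: cV2_eq; rewrite ?pt0 ?pt1 mxE // /beta pt1 eqxx subrr.
exact: (inj_eq mut_pt_inj).
Qed.

Lemma mut_pt_left (l : Lambda) : (mut_pt (val l) == pt_left) = false.
Proof.
have <- : mut_pt 0 = pt_left.
  by apply: cV2_eq; rewrite ?pt0 ?pt1 !mxE // /beta mxE eqxx sub0r.
by rewrite (inj_eq mut_pt_inj); apply/negbTE/(valP l).
Qed.

Lemma coeff_mut (l l' : Lambda) w : val l' = mut_pt (val l) ->
  coeff l' (mut_W w) = coeff l w.
Proof.
move=> e; elim/W_ind: w => [|l0|w w' IHw IHw']; first by rewrite !raddf0.
  rewrite mut_WU raddfB raddfMz /= !coeff_w coeff_basis e.
  rewrite [pt_left == _]eq_sym mut_pt_left mul0rz subr0.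
  by rewrite (inj_eq mut_pt_inj) (inj_eq val_inj).
by rewrite !raddfB /= IHw IHw'.
Qed.

Lemma lat_val_axis (l : Lambda) : val l ord_max ord0 = 0 ->
  lat_val l = axis_val (val l ord0 ord0).
Proof.
move=> l1; apply: (special_min_uniq (lat_valP l)); rewrite l1; apply: special_min_axis.
by have := Lambda_neq0 l; rewrite l1 eqxx orbF.
Qed.

Lemma lat_val_y1 (l : Lambda) : lat_val l (1 + y) = beta (val l).
Proof.
rewrite /beta; case: eqP => [l1|/eqP l1]; first by rewrite lat_val_axis // axis_val_y1.
exact: special_y1 (lat_special l).
Qed.

Lemma chart_ip n f : chart n (act ip f) = chart (n - 1) f.
Proof.
apply: (@rmorph_eq (chart n \o act ip : {rmorphism K -> K}) (chart (n - 1))) => [c|c||] /=.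
- by rewrite (mut_cst act_ip); apply: chart_cst.
- exact: chart_cst.
- rewrite (mut_x act_ip) rmorphM fmorphXz chart_y1 !chart_x.
  by rewrite -mulrA -expfzDr ?y_neq0.
- by rewrite (mut_y act_ip) !chart_y.
Qed.

Lemma axis_val_ip n : axis_val n \o act ip = axis_val (n - 1).
Proof. by apply/funext => f; rewrite /axis_val /= chart_ip. Qed.

(** The valuation of the divisor of i, with the curve 1 + y = 0 at i = 0. *)
Definition ext_val (i : 'cV[int]_2) : K -> int :=
  if insub i is Some l then lat_val (l : Lambda) else axis_val 0.

Lemma ext_val_axis n : ext_val (pt n 0) = axis_val n.
Proof.
rewrite /ext_val; case: insubP => [l _ e|]; first by rewrite lat_val_axis e ?pt0 ?pt1.
by rewrite negbK => /eqP/matrixP/(_ ord0 ord0); rewrite !mxE /= => ->.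
Qed.

Lemma lat_val_ip (l : Lambda) : lat_val l \o act ip = ext_val (mut_pt (val l)).
Proof.
have [l1|l1] := eqVneq (val l ord_max ord0) 0.
  by rewrite lat_val_axis // axis_val_ip /mut_pt /beta l1 eqxx ext_val_axis.
have mi := mutation_inv act_ip (@actK ip) (@actVK ip).
have h := special_min_mutation l1 act_ip mi (@actK ip) (lat_valP l).
rewrite /ext_val; case: insubP => [l' _ e|].
  apply: (special_min_uniq h); have := lat_valP l'.
  by rewrite e /mut_pt pt0 pt1 /beta (negPf l1) mulN1r.
by rewrite negbK => /eqP/matrixP/(_ ord_max ord0)/eqP; rewrite /mut_pt pt1 mxE (negPf l1).
Qed.

Lemma lat_val_left : lat_val lat_left = axis_val 0 \o act ip.
Proof. by rewrite axis_val_ip sub0r lat_val_axis /= ?pt0 ?pt1. Qed.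

Lemma coeff_mut_left w : coeff lat_left (mut_W w) = - lam (1 + y) w.
Proof.
elim/W_ind: w => [|l|w w' IHw IHw']; first by rewrite !raddf0 lam0 oppr0.
  rewrite mut_WU raddfB raddfMz /= !coeff_w mut_pt_left eqxx sub0r lamU lat_val_y1.
  by rewrite -mulrzl mulr1 intz.
by rewrite !raddfB lamB /= IHw IHw' opprD opprK.
Qed.

(** Both corrections come from the curve 1 + y = 0: the mutation turns a
   special divisor into this curve, and this curve into a special divisor. *)
Lemma lam_mut f w : lam f (mut_W w) = lam (act ip f) w
  - coeff lat_right w * axis_val 0 f - lam (1 + y) w * lat_val lat_left f.
Proof.
elim/W_ind: w => [|l|w w' IHw IHw'].
- by rewrite !raddf0 !lam0 !mul0r !subr0.
- rewrite mut_WU lamB lamMz !lamU lat_val_y1 coeff_basis.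
  have -> : w_ pt_left = << lat_left >> by rewrite -w_val.
  rewrite lamU mulrC; congr (_ - _).
  rewrite -[lat_val l (act ip f)]/((lat_val l \o act ip) f) lat_val_ip /ext_val.
  have -> : (l == lat_right) = (mut_pt (val l) == 0) by rewrite mut_pt_eq0.
  rewrite /w_; case: insubP => [l' /negPf n0 _|].
    by rewrite lamU n0 mul0r subr0.
  by rewrite negbK => ->; rewrite lam0 mul1r subrr.
rewrite !raddfB !lamB /= IHw IHw'; exact: sub_bilinear.
Qed.

Lemma transports_ip : transports (act ip) mut_W.
Proof.
move=> w w0; split; first by rewrite momentum_mut.
have aip1 : act ip (1 + y) = 1 + y := mut_y1 act_ip.
have left1 : lat_val lat_left (1 + y) = 1 by rewrite lat_val_y1 /= beta_pt_left.
move=> nu n [[l -> ->]|[f c ->]].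
  rewrite lat_val_ip /ext_val; case: insubP => [l' _ e|].
    by rewrite -(coeff_mut _ e); apply: has_coord_lat.
  (* The divisor of (1, 0) becomes the curve 1 + y = 0. *)
  rewrite negbK mut_pt_eq0 => /eqP lE; right; exists (1 + y); first exact: curve_y1.
  have -> : l = lat_right by apply: val_inj.
  by rewrite lam_mut aip1 axis_val_y1 left1 !mulr1 addrAC subrr sub0r opprK.
have [n0|n0] := eqVneq (nu (1 + y)) 0; last first.
  (* The curve 1 + y = 0 becomes the divisor of (-1, 0). *)
  have nuE := curve_y1_pos c n0; rewrite nuE -lat_val_left.
  have -> : - lam f w = coeff lat_left (mut_W w); last exact: has_coord_lat.
  rewrite coeff_mut_left; apply: (@has_coord_uniq w nu) => //; right; first by exists f.
  by exists (1 + y) => //; rewrite nuE; apply: curve_y1.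
(* Any other curve remains a curve. *)
right; have [k1 k2] := (@actK ip, @actVK ip); have mi := mutation_inv act_ip k1 k2.
have c' := curve_mutation act_ip mi k1 k2 c n0.
exists (act ip^-1%g f * (1 + y) ^ (- axis_val 0 (act ip^-1%g f))) => //.
have f0 := curve_neq0 c; have y10 := y1_neq0; have v0 := axis_valuation 0.
have f1 : act ip^-1%g f != 0 by rewrite fmorph_eq0.
set d := - axis_val 0 _; have dE : axis_val 0 (act ip^-1%g f) + d = 0 by rewrite subrr.
move: d dE => d dE.
have yd := expfz_neq0 d y10.
rewrite lam_mut rmorphM k2 fmorphXz aip1 lamM // lamXz.
rewrite (valM v0) // (valXz v0) axis_val_y1 mulr1 dE mulr0 subr0.
rewrite (valM (lat_valuation _)) // (valXz (lat_valuation _)) left1 mulr1.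
by rewrite {1}lat_val_left /= k2 (curve_coprime_y1 c n0) add0r [_ * d]mulrC addrK.
Qed.

(** The inverse of the mutation is conjugate to it by monomial maps, so that
   it need not be treated separately. *)

Lemma det_neg : \det (mx22 (-1) 0 0 (-1)) == 1.
Proof. by rewrite det_mx22; apply/eqP; ring. Qed.

Lemma det_shear : \det (mx22 (-1) (-1) 0 (-1)) == 1.
Proof. by rewrite det_mx22; apply/eqP; ring. Qed.

Definition SL2Z_neg : SL2Z := MkSL2Z det_neg.
Definition SL2Z_shear : SL2Z := MkSL2Z det_shear.

Lemma act_ipV f : act ip^-1%g f =
  act (gam SL2Z_neg) (act ip (act (gam SL2Z_shear) f)).
Proof.
have mi := mutation_inv act_ip (@actK ip) (@actVK ip).
have tn := act_gam SL2Z_neg; have ts := act_gam SL2Z_shear.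
rewrite /= !mxE /= in tn ts.
apply: (@rmorph_eq (act ip^-1%g)
  (act (gam SL2Z_neg) \o (act ip \o act (gam SL2Z_shear)) : {rmorphism K -> K}))
  => [c|c||] /=.
- exact: mut_cst mi c.
- by rewrite (toric_cst ts) (mut_cst act_ip); apply: toric_cst tn c.
- rewrite (mut_x mi) (toric_x ts) (mut_monomial _ _ act_ip) rmorphM (toric_monomial _ _ tn).
  rewrite fmorphXz rmorphD rmorph1 (toric_y tn) !(mulr0, mul0r, addr0, add0r) mulrNN mulr1.
  rewrite -[(1 + y) ^ _]/(1 + y) !expr1z expr0z mul1r exprN1.
  by rewrite -mulrA; congr (_ * _); rewrite mulrDr mulr1 mulfV ?y_neq0 // addrC.
- rewrite (mut_y mi) (toric_y ts) (mut_monomial _ _ act_ip) rmorphM (toric_monomial _ _ tn).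
  rewrite fmorphXz !(mulr0, mul0r, addr0, add0r) mulrNN mulr1.
  by rewrite !expr0z ?expr1z ?mul1r ?mulr1.
Qed.

Lemma transports_ipV :
  transports (act ip^-1%g) (gam_W SL2Z_shear \o (mut_W \o gam_W SL2Z_neg)).
Proof.
have -> : act ip^-1%g = act (gam SL2Z_neg) \o act ip \o act (gam SL2Z_shear) :> (K -> K).
  by apply/funext => f; exact: act_ipV.
apply: transports_comp (transports_gam _).
exact: transports_comp (transports_gam _) transports_ip.
Qed.

(** * The action on V *)

Lemma V_momentum (v : V) : momentum (val v) = 0.
Proof. exact/eqP/(valP v). Qed.

(** The automorphism A of V is the transport of coordinates along h. *)
Definition realizes (h : G) (A : zaut V) := forall (v : V) nu n,
  has_coord (val v) nu n <-> has_coord (val (A v)) (nu \o act h) n.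

Lemma val_actK (h : G) (nu : K -> int) : (nu \o act h) \o act h^-1%g = nu.
Proof. by apply/funext => f /=; rewrite actVK. Qed.

Lemma val_actVK (h : G) (nu : K -> int) : (nu \o act h^-1%g) \o act h = nu.
Proof. by apply/funext => f /=; rewrite actK. Qed.

(** Operators transporting coordinates along h and along its inverse are inverse
   to each other on V. *)
Lemma realizes_of (h : G) (F F' : {additive W -> W}) :
  transports (act h) F -> transports (act h^-1%g) F' ->
  exists2 A : zaut V, forall v, val (A v) = F (val v) & realizes h A.
Proof.
move=> hF hF'.
have lift (E : {additive W -> W}) s : transports s E ->
    exists2 B : V -> V, zmod_morphism B & forall v, val (B v) = E (val v).
  move=> hE; have EV (v : V) : E (val v) \in V_pred.
    by have [/eqP] := hE _ (V_momentum v).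
  exists (fun v => MkV (EV v)) => [u v|//].
  by apply: val_inj; rewrite /= !raddfB.
have [B Badd BE] := lift F _ hF; have [B' _ B'E] := lift F' _ hF'.
have FF' w : momentum w = 0 -> F' (F w) = w.
  by apply: (transports_id _ (transports_comp hF hF')) => f /=; rewrite actVK.
have F'F w : momentum w = 0 -> F (F' w) = w.
  by apply: (transports_id _ (transports_comp hF' hF)) => f /=; rewrite actK.
have Bbij : bijective B.
  exists B' => v; apply: val_inj; first by rewrite B'E BE FF' ?V_momentum.
  by rewrite BE B'E F'F ?V_momentum.
exists (ZAut Badd Bbij) => // v nu n /=; rewrite BE.
have v0 := V_momentum v; have [Fv0 hv] := hF _ v0; split; first exact: hv.
by have [_ h'] := hF' _ Fv0; move/h'; rewrite FF' // val_actK.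
Qed.

(** A coordinate of A v along a special divisor is the coordinate of v along the
   inverse image of this divisor under h, so is determined by h. *)
Lemma realizes_uniq h A B : realizes h A -> realizes h B -> A = B.
Proof.
move=> hA hB; apply: zautP => v; apply: val_inj; apply/eqP/freeg_eqP => l.
have cA := has_coord_lat (val (A v)) l; have cB := has_coord_lat (val (B v)) l.
rewrite -(val_actVK h (lat_val l)) in cA cB.
by apply: (has_coord_uniq (V_momentum v)); [apply/hA/cA | apply/hB/cB].
Qed.

Lemma realizes1 : realizes 1%g 1%g.
Proof.
move=> v nu n; have -> : nu \o act 1%g = nu by apply/funext => f /=; rewrite act1.
by [].
Qed.

Lemma realizesM h h' A B : realizes h A -> realizes h' B ->
  realizes (h * h')%g (A * B)%g.
Proof.
move=> hA hB v nu n.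
have -> : nu \o act (h * h')%g = (nu \o act h') \o act h.
  by apply/funext => f /=; rewrite actM.
by rewrite (hB v nu n) (hA (B v) (nu \o act h') n).
Qed.

Lemma realizesV h A : realizes h A -> realizes h^-1%g A^-1%g.
Proof.
move=> hA v nu n; rewrite (hA (A^-1%g v) (nu \o act h^-1%g) n) val_actVK.
by rewrite -[A (A^-1%g v)]/((A * A^-1)%g v) mulgV.
Qed.

Lemma act_gamV (g : SL2Z) : exists g' : SL2Z, act (gam g)^-1%g =1 act (gam g').
Proof.
have det := det_SL2Z g; have t := act_gam g.
have det' : \det (mx22 (val g ord_max ord_max) (- val g ord0 ord_max)
    (- val g ord_max ord0) (val g ord0 ord0)) == 1.
  by rewrite det_mx22; apply/eqP/(etrans _ det); ring.
exists (MkSL2Z det'); have t' := act_gam (MkSL2Z det'); rewrite /= !mxE /= in t'.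
have ti := toric_inv det t (@actK (gam g)) (@actVK (gam g)).
apply: rmorph_eq => [c|c||];
  rewrite ?(toric_x ti) ?(toric_x t') ?(toric_y ti) ?(toric_y t') //.
- exact: toric_cst ti c.
- exact: toric_cst t' c.
Qed.

Lemma realizes_gam (g : SL2Z) : exists2 A : zaut V,
  forall v, val (A v) = gam_W g (val v) & realizes (gam g) A.
Proof.
have [g' /funext e] := act_gamV g; apply: (realizes_of (transports_gam g)).
by rewrite e; apply: transports_gam.
Qed.

Lemma realizes_ip : exists2 A : zaut V,
  forall v, val (A v) = mut_W (val v) & realizes ip A.
Proof.
exact: (realizes_of transports_ip transports_ipV).
Qed.

(** The properties of the relation [realizes], in a form free of the data used
   to construct it. *)
Theorem exists_realizes : exists realizes : G -> zaut V -> Prop,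
  [/\ forall h A B, realizes h A -> realizes h B -> A = B,
      realizes 1%g 1%g /\ (forall h A, realizes h A -> realizes h^-1%g A^-1%g),
      forall h h' A B, realizes h A -> realizes h' B ->
        realizes (h * h')%g (A * B)%g,
      forall g : SL2Z, exists2 A : zaut V,
        forall v, val (A v) = gam_W g (val v) & realizes (gam g) A &
      exists2 A : zaut V,
        forall v, val (A v) = mut_W (val v) & realizes ip A].
Proof.
exists realizes; split.
- exact: realizes_uniq.
- by split; [exact: realizes1 | exact: realizesV].
- exact: realizesM.
- exact: realizes_gam.
- exact: realizes_ip.
Qed.

End FractionField.

(** * The theorem *)

Lemma mul_expzNK (F : fieldType) (a b : F) n : b != 0 -> a * b ^ (- n) * b ^ n = a.
Proof. by move=> b0; rewrite -mulrA -expfzDr // addNr mulr1. Qed.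

Section Instance.
Variable R : realType.
Local Notation C := (complex R).
Local Notation K := (ratfun R).
Local Notation x := (Kx R).
Local Notation y := (Ky R).

Lemma substB w (f g : K) : dominant w -> subst w (f - g) = subst w f - subst w g.
Proof.
move=> dw; apply: substE => //; apply: has_valueD; first exact: dominant_value.
have -> : - g = cstK R (-1) * g by rewrite rmorphN1 mulN1r.
have -> : - subst w g = cstK R (-1) * subst w g by rewrite rmorphN1 mulN1r.
by apply: has_valueM; [exact: has_value_cst | exact: dominant_value].
Qed.

Lemma subst_monoid_morphism w : dominant w -> monoid_morphism (@subst R w).
Proof.
move=> dw; split=> [|f g]; last exact: substM.
by apply: substE => //; apply: has_value11.
Qed.

Definition pullback w (dw : dominant w) : {rmorphism K -> K} :=
  HB.pack (@subst R w)
    (GRing.isZmodMorphism.Build K K (subst w) (fun f g => substB f g dw))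
    (GRing.isMonoidMorphism.Build K K (subst w) (subst_monoid_morphism dw)).

Lemma pullback_cst w (dw : dominant w) c : pullback dw (cstK R c) = cstK R c.
Proof. by apply: substE => //; apply: has_value_cst. Qed.

Lemma pullback_x w (dw : dominant w) : pullback dw x = w.1.
Proof. by apply: substE => //; apply: (has_value_coord w ord0). Qed.

Lemma pullback_y w (dw : dominant w) : pullback dw y = w.2.
Proof. by apply: substE => //; apply: (has_value_coord w ord_max). Qed.

Lemma ratfun_frac (f : K) : exists p q : {mpoly C[2]},
  q != 0 /\ f = FracField.tofrac p / FracField.tofrac q.
Proof. by exists \n_(repr f), \d_(repr f); split; [exact: denom_ratioP | exact: frac_nd]. Qed.

Lemma swap_dominant : dominant (y, x).
Proof.
by apply: (@has_value_dominant _ _ (y, x));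
  [exact: (has_value_coord _ ord_max) | exact: (has_value_coord _ ord0)].
Qed.

Definition chart_map (n : int) : ratmap R := (x * y ^ n, y - 1).

Lemma chart_dominant n : dominant (chart_map n).
Proof.
pose w : ratmap R := (x * (1 + y) ^ (- n), 1 + y).
have wy : has_value w y (1 + y) := has_value_coord w ord_max.
have wx : has_value w x (x * (1 + y) ^ (- n)) := has_value_coord w ord0.
have y10 : 1 + y != 0 := add1X_neq0 R ord_max.
apply: (@has_value_dominant _ _ w) => /=.
  rewrite -[X in has_value _ _ X](mul_expzNK x n y10).
  exact: has_valueM wx (has_valueXz n y10 wy).
rewrite -[X in has_value _ _ X](addKr 1 y) addrC -(rmorphN1 (cstK R)).
by apply: has_valueD => //; apply: has_value_cst.
Qed.

Definition act (h : birat R) : {rmorphism K -> K} := pullback (@birat_dominant R h).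

Lemma actM (g h : birat R) f : act (g * h)%g f = act h (act g f).
Proof. by rewrite /= -subst_comp //; apply: birat_dominant. Qed.

Lemma act1 f : act 1%g f = f.
Proof.
by rewrite /act /= -[LHS]/(subst (ratid R) f); have [] := ratcomp_id (f, f).
Qed.

Lemma act_gam (g : SL2Z) :
  toric (@FracField.tofrac {mpoly C[2]}) (val g ord0 ord0) (val g ord0 ord_max)
        (val g ord_max ord0) (val g ord_max ord_max) (act (birmono R g)).
Proof.
split; [exact: pullback_cst | exact: pullback_x | exact: pullback_y].
Qed.

Definition IP : birat R := (birmono R SL2Z_I * birP R)%g.

Lemma act_IP : mutation (@FracField.tofrac {mpoly C[2]}) (- 1) (act IP).
Proof.
have e := IP_mapE R; split; first exact: pullback_cst.
  by rewrite (pullback_x (@birat_dominant R IP)) e.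
by rewrite (pullback_y (@birat_dominant R IP)) e.
Qed.

Lemma tofrac_inj : injective (@FracField.tofrac {mpoly C[2]}).
Proof. by move=> p q /eqP; rewrite tofrac_eq => /eqP. Qed.

Lemma birat_realizes : exists realizes : birat R -> zaut V -> Prop,
  [/\ forall h A B, realizes h A -> realizes h B -> A = B,
      realizes 1%g 1%g /\ (forall h A, realizes h A -> realizes h^-1%g A^-1%g),
      forall h h' A B, realizes h A -> realizes h' B ->
        realizes (h * h')%g (A * B)%g,
      forall g : SL2Z, exists2 A : zaut V,
        forall v, val (A v) = gam_W g (val v) & realizes (birmono R g) A &
      exists2 A : zaut V,
        forall v, val (A v) = mut_W (val v) & realizes IP A].
Proof.
exact: (exists_realizes tofrac_inj ratfun_frac (swap := pullback swap_dominant)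
  (pullback_cst swap_dominant) (pullback_x swap_dominant) (pullback_y swap_dominant)
  (chart := fun n => pullback (@chart_dominant n))
  (fun n => pullback_cst (@chart_dominant n))
  (fun n => pullback_x (@chart_dominant n))
  (fun n => pullback_y (@chart_dominant n)) actM act1 act_gam act_IP).
Qed.

End Instance.

Lemma V_to_Wq_gam (g : SL2Z) (v w : V) : val w = gam_W g (val v) ->
  V_to_Wq w = Gamma_act g (V_to_Wq v).
Proof. by rewrite /V_to_Wq Gamma_act_W => ->. Qed.

Lemma V_to_Wq_mu (v w : V) : val w = mut_W (val v) -> V_to_Wq w = mu (V_to_Wq v).
Proof.
by rewrite /V_to_Wq mu_W (V_momentum v) mxE polyC0 mulr0 scale0r addr0 => ->.
Qed.

Theorem mainTheorem1 (R : realType) :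
  [/\ (forall v : V, exists w : V, mu (V_to_Wq v) = V_to_Wq w),
      (forall (g : SL2Z) (v : V), exists w : V,
         Gamma_act g (V_to_Wq v) = V_to_Wq w) &
      exists rho : {multiplicative groupH R -> zaut V},
        (forall (g : SL2Z) (v : V),
           V_to_Wq (rho (HSL2Z R g) v) = Gamma_act g (V_to_Wq v)) /\
        (forall v : V,
           V_to_Wq (rho (HSL2Z R SL2Z_I * HP R)%g v) = mu (V_to_Wq v))].
Proof.
have [Rz [uniq [Rz1 RzV] RzM Rz_gam Rz_ip]] := birat_realizes R.
have RzP : exists A, Rz (birP R) A.
  have [A _ hA] := Rz_gam SL2Z_I; have [B _ hB] := Rz_ip.
  by exists (A^-1 * B)%g; have := RzM _ _ _ _ (RzV _ _ hA) hB; rewrite mulKg.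
have RzH (h : groupH R) : exists A, Rz (val h) A.
  have /asboolP := valP h.
  elim: (val h) / => [|g||phi psi _ [A hA] _ [B hB]|phi _ [A hA]] //.
  - by have [A _ hA] := Rz_gam g; exists A.
  - by exists 1%g.
  - by exists (A * B)%g; apply: RzM.
  - by exists A^-1%g; apply: RzV.
pose rho h := sval (cid (RzH h)); have rhoP h : Rz (val h) (rho h) := svalP (cid (RzH h)).
have rhoM : {morph rho : g h / (g * h)%g}.
  by move=> g h; exact: (uniq _ _ _ (rhoP (g * h)%g) (RzM _ _ _ _ (rhoP g) (rhoP h))).
have rho_gam (g : SL2Z) (v : V) : val (rho (HSL2Z R g) v) = gam_W g (val v).
  by have [A <- hA] := Rz_gam g; rewrite (uniq _ _ _ hA (rhoP (HSL2Z R g))).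
have rho_ip (v : V) : val (rho (HSL2Z R SL2Z_I * HP R)%g v) = mut_W (val v).
  by have [A <- hA] := Rz_ip; rewrite (uniq _ _ _ hA (rhoP (HSL2Z R SL2Z_I * HP R)%g)).
split=> [v|g v|].
- by exists (rho (HSL2Z R SL2Z_I * HP R)%g v); apply/esym/V_to_Wq_mu.
- by exists (rho (HSL2Z R g) v); apply/esym/V_to_Wq_gam.
pose rho' : {multiplicative groupH R -> zaut V} :=
  HB.pack rho (isMultiplicative.Build (groupH R) (zaut V) rho rhoM).
exists rho'.
by split=> *; [apply: V_to_Wq_gam | apply: V_to_Wq_mu].
Qed.
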